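(* Let $t>0$. If $\theta$ is distributed according to the density $$a_t(\theta)=2\log[r_t(\theta)]\,w_t(\theta)$$ (on the set of angles $\theta$ whose ray from the origin meets $\Sigma_t$), and $\phi$ is defined by $$f_t(r_t(\theta)e^{i\theta})=e^{i\phi},$$ then $\phi$ is distributed as Biane's measure $\nu_t$ (that is, $e^{i\phi}$ has law $\nu_t$ on the unit circle).
   Context: Let $f_t(\lambda)=\lambda e^{\frac t2\frac{1+\lambda}{1-\lambda}}$ on $\mathbb C\setminus\{1\}$, $F_t=\{\lambda\in\mathbb C:\ |\lambda|\ne1,\ |f_t(\lambda)|=1\}$, $E_t=\overline{F_t}$, and let $\Sigma_t$ be the connected component of $\mathbb C\setminus E_t$ containing $1$. If the ray from the origin with angle $\theta\in(-\pi,\pi]$ meets $\Sigma_t$ (which happens for all $\theta$ if $t>4$, and for $|\theta|<\cos^{-1}(1-t/2)$ if $t\le4$), it does so in an interval $1/r_t(\theta)<r<r_t(\theta)$ with $r_t(\theta)>1$. For such $\theta$, $$w_t(\theta)=\frac{1}{4\pi}\left(\frac{2}{t}+\frac{\partial}{\partial\theta}\,\frac{2r_t(\theta)\sin\theta}{r_t(\theta)^2+1-2r_t(\theta)\cos\theta}\right),$$ so that $\frac1{r^2}w_t(\theta)$ is the density on $\Sigma_t$, in polar coordinates, of the Brown measure of the free multiplicative Brownian motion, and $a_t$ is the density of the argument of $\lambda$ under that Brown measure. The boundary of $\Sigma_t$ is mapped into the unit circle by $f_t$. Biane's measure $\nu_t$ is the spectral measure (on the unit circle $S^1$) of the free unitary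 Brownian motion $u_t$, the solution of $du_t=iu_t\,dx_t-\frac12u_t\,dt$, $u_0=1$, where $x_t$ is a free additive (semicircular) Brownian motion. Biane's known description: $f_t$ has a holomorphic inverse $\chi_t$ on the open unit disk ($f_t(\chi_t(z))=z$, $\chi_t(0)=0$), which extends continuously to the closed unit disk; $\nu_t$ has the continuous density $\kappa_t(e^{i\phi})=\frac1{2\pi}\frac{1-|\chi_t(e^{i\phi})|^2}{|1-\chi_t(e^{i\phi})|^2}$ with respect to $d\phi$; it is supported in the arc $|\phi|\le\phi_{\max}(t)=\frac12\sqrt{(4-t)t}+\cos^{-1}(1-t/2)$ for $t<4$ and on the full circle for $t\ge4$. *)

(* Defs.v *)
From HB Require Import structures.
From mathcomp Require Import all_boot all_order all_algebra.
From mathcomp Require Import all_classical all_reals all_analysis.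
From mathcomp Require Import complex.

Set Implicit Arguments.
Unset Strict Implicit.
Unset Printing Implicit Defensive.

Import Order.TTheory GRing.Theory Num.Theory.
Import numFieldNormedType.Exports.

Local Open Scope classical_set_scope.
Local Open Scope ring_scope.
Local Open Scope complex_scope.

(* The complex plane with the topology of the modulus: [R[i]] itself carries no
   topology in the libraries, but its regular module [R[i]^o] does.  *)
Notation plane R := ((R[i])^o).

(* The complex plane with its Borel sigma-algebra.  *)
Notation borel_plane R := (g_sigma_algebraType (@open (plane R))).

Definition expC (R : realType) (z : R[i]) : R[i] :=
  (expR (complex.Re z) * cos (complex.Im z))
    +i* (expR (complex.Re z) * sin (complex.Im z)).

Definition cis (R : realType) (theta : R) : R[i] := cos theta +i* sin theta.

Section Domain.
Variables (R : realType) (t : R).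

(* At the excluded point 1 the convention x / 0 = 0 gives the value 1; this is
   never used, since F_t only involves points off the unit circle and
   1 lies in Sigma_t.  *)
Definition f_t (lambda : R[i]) : R[i] :=
  lambda * expC ((t / 2)%:C * ((1 + lambda) / (1 - lambda))).

Definition F_t : set (plane R) :=
  [set lambda | `|lambda : R[i]| != 1 /\ `|f_t lambda| = 1].

Definition E_t : set (plane R) := closure F_t.

Definition Sigma_t : set (plane R) := connected_component (~` E_t) 1.

Definition radii (theta : R) : set R :=
  [set r | 0 < r /\ Sigma_t (r%:C * cis theta)].

Definition angles : set R :=
  [set theta | theta \in `]- pi, pi] /\ radii theta !=set0].

(* The upper endpoint of the interval in which the ray of angle theta meets
   Sigma_t.  It is defined for every real theta, hence 2 pi-periodic, so that
   the derivative in [w_t] is also the intended one at theta = pi.  *)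
Definition r_t (theta : R) : R := sup (radii theta).

Definition w_t (theta : R) : R :=
  1 / (4 * pi) *
  (2 / t +
   derive1 (fun s : R => 2 * r_t s * sin s
                         / (r_t s ^+ 2 + 1 - 2 * r_t s * cos s)) theta).

Definition a_t (theta : R) : R := 2 * ln (r_t theta) * w_t theta.

End Domain.

Definition prob_density (R : realType) (D : set R) (g : R -> R) : Prop :=
  [/\ measurable D, measurable_fun D g, (forall x, D x -> 0 <= g x) &
      (\int[lebesgue_measure]_(x in D) (g x)%:E = 1)%E].

Definition has_density (R : realType) d (Omega : measurableType d)
    (P : probability Omega R) (X : {RV P >-> R}) (D : set R) (g : R -> R) :
    Prop :=
  forall B : set R, measurable B ->
    (distribution P X B = \int[lebesgue_measure]_(x in D `&` B) (g x)%:E)%E.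

Section Biane.
Variables (R : realType) (t : R).

(* chi is the holomorphic inverse of f_t on the open unit disk, extended by
   continuity to the closed disk.  *)
Definition is_chi (chi : plane R -> plane R) : Prop :=
  [/\ (forall z : R[i], `|z| < 1 -> derivable chi z 1),
      {within [set z : plane R | `|z : R[i]| <= 1], continuous chi},
      (forall z : R[i], `|z| < 1 -> f_t t (chi z) = z) &
      chi 0 = 0].

Definition kappa (chi : plane R -> plane R) (z : R[i]) : R :=
  1 / (2 * pi) *
  ((1 - Normc.normc (chi z) ^+ 2) / Normc.normc (1 - chi z) ^+ 2).

(* Biane's description of the spectral measure of the free unitary Brownian
   motion at time t: density kappa with respect to arc length d phi on the unit
   circle, which is parametrized by phi in ]-pi, pi].  *)
Definition is_biane_measure (nu : probability (borel_plane R) R) : Prop :=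
  exists2 chi, is_chi chi &
    forall B : set (borel_plane R), measurable B ->
      (nu B = \int[lebesgue_measure]_(phi in
                 [set phi : R | phi \in `]- pi, pi]%R /\ B (cis phi)])
               (kappa chi (cis phi))%:E)%E.

End Biane.

(* Main.v *)
(** In polar coordinates,
      [|f_t (exp (s + i x))| = exp (s (P s - cos x) / (cosh s - cos x))],
    where [P s = cosh s - (t / 2) sinh s / s].  As [P] is even and crosses every
    level of [[-1, 1]] at most once on [s > 0], [Sigma_t] is the set
    [P (ln |z|) < cos (arg z)], and [S = ln (r_t x)] is the positive solution of
    [P S = cos x].  On this curve [f_t (r_t x e^(i x)) = e^(i phi(x))] with
    [phi x = x + (t / 2) g x], where [g] is the function differentiated in
    [w_t].  Hence [w_t = phi' / (2 pi t)] and [a_t = (S / (pi t)) phi'],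
    with [phi' > 0].

    On the other side, [chi (e^(i phi(x))) = e^(-S + i x)], the reflection of the
    boundary point: on the segment from 0 to that point [f_t] takes values in the
    disk and has no critical point, so the set where [chi o f_t = id] is open and
    closed.  Substituting in Biane's formula, [kappa (e^(i phi(x))) = S / (pi t)],
    so that [a_t dx = kappa d phi]; moreover [kappa] vanishes at the points of
    the circle that are not reached by [phi]. *)
Require Import Defs.
From HB Require Import structures.
From mathcomp Require Import all_boot all_order all_algebra.
From mathcomp Require Import all_classical all_reals all_analysis.
From mathcomp Require Import measurable_realfun complex ring lra.
Set Implicit Arguments.
Unset Strict Implicit.
Unset Printing Implicit Defensive.

Import Order.TTheory GRing.Theory Num.Theory.
Import numFieldNormedType.Exports.
Local Open Scope classical_set_scope.
Local Open Scope ring_scope.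
Local Open Scope complex_scope.

(** [P] itself is not monotone: for [t > 6] it first decreases. Uniqueness of the crossing comes
    from solving [P s = c] for [t / 2]: the resulting function [s (cosh s - c) / sinh s] of [s > 0]
    increases as soon as [c >= -1], which cosines satisfy. Three obstacles shape the rest. [Sigma_t]
    is a component of the complement of a closure, so it has to be recovered from a continuous
    function on the whole plane, including the origin, where polar coordinates fail. The map [chi]
    is given only as a right inverse of [f_t] inside the disk, so its boundary values are
    transported from 0 along a segment on which [f_t] stays locally injective. Finally [f_t]
    determines an angle only modulo [2 pi], so [phase] has to be confined to []-pi, pi[] before
    densities on the line can be compared. The mass of [a_t] is not computed: it equals 1 because
    the change of variables identifies it with the mass of the probability [nu]. *)

(** * Hyperbolic inequalities and the monotone form of the boundary equation *)

Section Hyperbolic.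
Context {R : realType}.
Implicit Types s x y : R.

Definition sinh s : R := (expR s - expR (- s)) / 2.
Definition cosh s : R := (expR s + expR (- s)) / 2.

Global Instance is_derive_sinh x : is_derive x 1 sinh (cosh x).
Proof.
rewrite /sinh /cosh; apply: is_derive_eq.
by rewrite /GRing.scale /=; ring.
Qed.

Global Instance is_derive_cosh x : is_derive x 1 cosh (sinh x).
Proof.
rewrite /sinh /cosh; apply: is_derive_eq.
by rewrite /GRing.scale /=; ring.
Qed.

Lemma sinh0 : sinh 0 = 0.
Proof. by rewrite /sinh oppr0 subrr mul0r. Qed.

Lemma cosh0 : cosh 0 = 1.
Proof. by rewrite /cosh oppr0 expR0; field. Qed.

Lemma sinhN s : sinh (- s) = - sinh s.
Proof. by rewrite /sinh opprK; ring. Qed.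

Lemma coshN s : cosh (- s) = cosh s.
Proof. by rewrite /cosh opprK addrC. Qed.

Lemma cosh_sqr s : cosh s ^+ 2 = 1 + sinh s ^+ 2.
Proof.
rewrite /cosh /sinh; have : expR s * expR (- s) = 1 by rewrite -expRD subrr expR0.
by move=> e; field: e.
Qed.

Lemma cosh_ge1 s : 1 <= cosh s.
Proof.
have := expR_gt0 s; have := expR_gt0 (- s).
have : expR s * expR (- s) = 1 by rewrite -expRD subrr expR0.
rewrite /cosh; set a := expR s; set b := expR (- s) => ab b0 a0.
have : 0 <= b * (a - 1) ^+ 2 by rewrite mulr_ge0 ?sqr_ge0// ltW.
have -> : b * (a - 1) ^+ 2 = a + b - 2 by ring: ab.
lra.
Qed.

Lemma cosh_gt0 s : 0 < cosh s.
Proof. by have := cosh_ge1 s; lra. Qed.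

Lemma expR_cosh_sinh s : expR s = cosh s + sinh s.
Proof. by rewrite /cosh /sinh; field. Qed.

Lemma sinh_double s : sinh (s + s) = 2 * sinh s * cosh s.
Proof. by rewrite /cosh /sinh opprD !expRD; field. Qed.

Lemma cosh_double s : cosh (s + s) = 1 + 2 * sinh s ^+ 2.
Proof.
rewrite /cosh /sinh opprD !expRD.
have : expR s * expR (- s) = 1 by rewrite -expRD subrr expR0.
by move=> e; field: e.
Qed.

(** The mean value theorem on [[0, s]]; it reduces each hyperbolic inequality below to the sign of a
    derivative. *)
Lemma derive_gt0_gt0 (f df : R -> R) s :
  (forall x, is_derive x 1 f (df x)) -> (forall x, 0 < x -> 0 < df x) ->
  f 0 = 0 -> 0 < s -> 0 < f s.
Proof.
move=> fdf df0 f0 s0; rewrite -[ltRHS]subr0 -{2}f0.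
have [|c] := @MVT R f df 0 s s0 (fun x _ => fdf x).
  by apply: derivable_within_continuous => x _; have [] := fdf x.
by rewrite in_itv/= => /andP[c0 _] ->; rewrite mulr_gt0 ?df0// subr0.
Qed.

Lemma sinh_gt0 s : 0 < s -> 0 < sinh s.
Proof.
by apply: (@derive_gt0_gt0 sinh cosh) => [x _|]; [exact: cosh_gt0|exact: sinh0].
Qed.

Lemma sinh_gt_id s : 0 < s -> s < sinh s.
Proof.
move=> s0; rewrite -subr_gt0.
apply: (@derive_gt0_gt0 (fun x => sinh x - x) (fun x => cosh x - 1)) => //.
- move=> x x0; have := cosh_sqr x; have := sinh_gt0 x0; have := cosh_ge1 x.
  nra.
- by rewrite sinh0 subrr.
Qed.

Lemma sinh_lt_mul_cosh s : 0 < s -> sinh s < s * cosh s.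
Proof.
move=> s0; rewrite -subr_gt0.
apply: (@derive_gt0_gt0 (fun x => x * cosh x - sinh x) (fun x => x * sinh x)).
- by move=> x; apply: is_derive_eq; rewrite /GRing.scale /=; ring.
- by move=> x x0; rewrite mulr_gt0// sinh_gt0.
- by rewrite sinh0 mul0r subrr.
- by [].
Qed.

(** With [u = s / 2] the two sides become [4 sinh u cosh u] and [4 u (cosh u)^2], so this is
    [sinh u < u cosh u] again. *)
Lemma two_sinh_lt s : 0 < s -> 2 * sinh s < s * (cosh s + 1).
Proof.
move=> s0; have -> : s = s / 2 + s / 2 by field.
have h0 : 0 < s / 2 by lra.
rewrite sinh_double cosh_double; have := cosh_sqr (s / 2).
have := sinh_lt_mul_cosh h0; have := cosh_gt0 (s / 2).
set u := s / 2; set a := sinh u; set b := cosh u => b0 ab e.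
have : b * a < b * (u * b) by rewrite ltr_pM2l.
have -> : (u + u) * (1 + 2 * a ^+ 2 + 1) = 4 * (b * (u * b)) by ring: e.
lra.
Qed.

(* Numerator of the derivatives of [level] and [profile]. *)
Definition wronskian s c : R :=
  cosh s * sinh s - s + c * (s * cosh s - sinh s).

(** The expression is affine in [c] with slope [s cosh s - sinh s > 0], and at [c = -1] it factors
    as [(sinh s - s) (cosh s + 1)]. *)
Lemma wronskian_gt0 s c : 0 < s -> -1 <= c -> 0 < wronskian s c.
Proof.
move=> s0 c1; have -> : wronskian s c =
  (sinh s - s) * (cosh s + 1) + (c + 1) * (s * cosh s - sinh s).
  by rewrite /wronskian; ring.
rewrite ltr_pwDl ?mulr_gt0 ?mulr_ge0 ?subr_ge0 ?subr_gt0 ?sinh_gt_id//.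
- by have := cosh_gt0 s; lra.
- by lra.
- exact/ltW/sinh_lt_mul_cosh.
Qed.

(** The equation [P s = c] solved for [t / 2]; this side is free of [t] and monotone in [s]. *)
Definition level s c : R := s * (cosh s - c) / sinh s.

Lemma level_lt s1 s2 c : 0 < s1 -> s1 < s2 -> -1 <= c ->
  level s1 c < level s2 c.
Proof.
move=> s10 s12 c1; rewrite -subr_gt0.
have D x : 0 < x ->
    is_derive x 1 (level ^~ c) (wronskian x c / sinh x ^+ 2).
  move=> x0; have sx := lt0r_neq0 (sinh_gt0 x0).
  have ? := is_deriveV sx (is_derive_sinh x).
  rewrite /level; apply: is_derive_eq; rewrite /GRing.scale /= /wronskian.
  have := cosh_sqr x => e.
  by field: e.
have [||d] := @MVT R (level ^~ c) (fun x => wronskian x c / sinh x ^+ 2) _ _ s12.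
- by move=> x /[!in_itv]/= /andP[x1 _]; apply: D; exact: lt_trans x1.
- apply: derivable_within_continuous => x /[!in_itv]/= /andP[x1 _].
  by have [] := D x (lt_le_trans s10 x1).
rewrite in_itv/= => /andP[d0 _] ->; have dgt0 := lt_trans s10 d0.
by rewrite !mulr_gt0 ?subr_gt0 ?invr_gt0 ?exprn_gt0 ?sinh_gt0 ?wronskian_gt0.
Qed.

(** The left side is the limit of [level] at [s = 0], so this extends the monotonicity to the
    endpoint 0. After clearing [sinh s] the difference is affine in [c], with slope [sinh s - s > 0]
    and, at [c = -1], the value bounded by [two_sinh_lt]. *)
Lemma level_gt s c : 0 < s -> -1 <= c -> 1 - c < level s c.
Proof.
move=> s0 c1; rewrite /level ltr_pdivlMr ?sinh_gt0//.
have := two_sinh_lt s0; have := sinh_gt_id s0; nra.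
Qed.

Definition sinhc s : R := if s == 0 then 1 else sinh s / s.

Lemma sinhcN s : sinhc (- s) = sinhc s.
Proof. by rewrite /sinhc oppr_eq0 sinhN invrN mulrNN. Qed.

Lemma continuous_sinhc : continuous sinhc.
Proof.
move=> x; have [->|x0] := eqVneq x 0.
  (* The Caratheodory slope of [sinh] at 0 is [sinhc] itself, value at 0 included, so its continuity
     there is the differentiability of [sinh]. *)
  have /is_derive1_caratheodory[g [gE gc g1]] := is_derive_sinh 0.
  suff -> : sinhc = g by [].
  apply/funext => s; rewrite /sinhc; case: eqVneq => [->|s0].
    by rewrite g1 cosh0.
  by have := gE s; rewrite sinh0 !subr0 => ->; rewrite mulfK.
have cS : {for x, continuous sinh}.
  by apply/differentiable_continuous/derivable1_diffP.
have : sinh s / s @[s --> x] --> sinh x / x by apply: cvgM => //; exact: cvgV.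
rewrite /continuous_at {2}/sinhc (negbTE x0); apply: cvg_trans.
apply: near_eq_cvg; near=> s; rewrite /sinhc ifF//; apply/negbTE.
by near: s; exact: open_neq.
Unshelve. all: by end_near. Qed.

End Hyperbolic.

(** * The radial profile of [Sigma_t] *)

Section Profile.
Context {R : realType}.
Variable t : R.
Implicit Types s c : R.

(** This is [P], with its removable singularity at 0 filled in. *)
Definition profile s : R := cosh s - t / 2 * sinhc s.

Lemma profile0 : profile 0 = 1 - t / 2.
Proof. by rewrite /profile cosh0 /sinhc eqxx mulr1. Qed.

Lemma profileN s : profile (- s) = profile s.
Proof. by rewrite /profile coshN sinhcN. Qed.

Lemma profile_norm s : profile `|s| = profile s.
Proof. by case: (ger0P s) => _; rewrite ?profileN. Qed.

Lemma continuous_profile : continuous profile.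
Proof.
move=> x; apply: cvgB.
  by apply/differentiable_continuous/derivable1_diffP.
by apply: cvgM; [exact: cvg_cst|exact: continuous_sinhc].
Qed.

(** Factoring out the positive [sinh s / s] turns every comparison of [profile] with [c] into one of
    [level] with [t / 2]. *)
Lemma profileB s c : 0 < s ->
  profile s - c = sinh s / s * (level s c - t / 2).
Proof.
move=> s0; rewrite /profile /sinhc gt_eqF// /level.
have := lt0r_neq0 (sinh_gt0 s0) => ?; have ? := lt0r_neq0 s0.
by field; apply/andP.
Qed.

Lemma profile_lt s c : 0 < s -> (profile s < c) = (level s c < t / 2).
Proof.
move=> s0; rewrite -subr_lt0 profileB// pmulr_rlt0 ?subr_lt0//.
by rewrite divr_gt0// sinh_gt0.
Qed.

Lemma profile_le s c : 0 < s -> (profile s <= c) = (level s c <= t / 2).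
Proof.
move=> s0; rewrite -subr_le0 profileB// pmulr_rle0 ?subr_le0//.
by rewrite divr_gt0// sinh_gt0.
Qed.

(** The substitute for monotonicity: on [s >= 0] the sublevel sets of [profile] at levels [c >= -1]
    are initial segments, by [level_lt], or by [level_gt] when [s1 = 0]. *)
Lemma profile_lt_lt s1 s2 c : 0 <= s1 -> s1 < s2 -> -1 <= c ->
  profile s2 <= c -> profile s1 < c.
Proof.
move=> s10 s12 c1; have s20 := le_lt_trans s10 s12.
rewrite profile_le// => h2; move: s10; rewrite le_eqVlt => /predU1P[<-|s10].
  by rewrite profile0; have := level_gt s20 c1; lra.
by rewrite profile_lt// (lt_le_trans _ h2)// level_lt.
Qed.

Lemma profile_large : 0 < t -> exists2 M, 0 < M & forall s, M <= s -> 1 < profile s.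
Proof.
(* For [s >= t] the subtracted term is at most [sinh s / 2], and [cosh s - sinh s / 2 > expR s / 4
   >= (1 + s) / 4], which exceeds 1 for [s > 3]. *)
move=> t_gt0; exists (t + 4) => [|s Ms]; first by rewrite addr_gt0.
have s0 : 0 < s by lra.
have e1 := expR_ge1Dx s; have e0 := expR_gt0 (- s).
have h : t / 2 * (sinh s / s) <= sinh s / 2.
  rewrite mulrA ler_pdivrMr// mulrAC [leRHS]mulrAC ler_pM2r//.
  by rewrite [leRHS]mulrC ler_pM2r ?sinh_gt0//; lra.
rewrite /profile /sinhc gt_eqF//.
suff : 1 < cosh s - sinh s / 2 by lra.
by rewrite /cosh /sinh; lra.
Qed.

Lemma profile_surj c : 0 < t -> c <= 1 -> profile 0 < c ->
  exists2 s, 0 < s & profile s = c.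
Proof.
move=> t_gt0 c1 h0; have [M M0 hM] := profile_large t_gt0.
have [|s] := @IVT _ profile 0 M c (ltW M0)
  (continuous_subspaceT continuous_profile).
  have h1 := hM _ (lexx M).
  by rewrite ge_min le_max (ltW h0)/= (le_trans c1 (ltW h1)) orbT.
rewrite in_itv/= => /andP[s0 _] hs; exists s => //.
by rewrite lt_neqAle s0 andbT; apply: contraTneq h0 => ->; rewrite hs ltxx.
Qed.

Lemma profile_ltE (S c s : R) : 0 < S -> -1 <= c -> profile S = c ->
  (profile s < c) = (`|s| < S).
Proof.
move=> S0 c1 hS; rewrite -profile_norm; case: ltP => [|] h.
  apply/esym; rewrite ltNge; apply: contraTN h; rewrite -leNgt le_eqVlt.
  move=> /predU1P[<-|Ss]; first by rewrite hS.
  by rewrite leNgt; apply/negP => /ltW/(profile_lt_lt (ltW S0) Ss c1); rewrite hS ltxx.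
apply/esym; rewrite ltNge; apply/negbTE/negPn; rewrite leNgt; apply/negP => sS.
by have := profile_lt_lt (normr_ge0 s) sS c1; rewrite hS lexx => /(_ isT); rewrite ltNge h.
Qed.

(** Taking [wronskian] at the level [profile s] itself makes the derivative visibly positive
    wherever [profile s >= -1], in particular on the boundary curve, where implicit differentiation
    divides by it. *)
Lemma is_derive_profile s : 0 < s ->
  is_derive s 1 profile (wronskian s (profile s) / (s * sinh s)).
Proof.
move=> s0; have s_neq0 := lt0r_neq0 s0; have sh0 := lt0r_neq0 (sinh_gt0 s0).
have ? := is_deriveV s_neq0 (is_derive_id s 1).
have D : is_derive s 1 (fun s => cosh s - t / 2 * (sinh s / s))
    (wronskian s (profile s) / (s * sinh s)).
  apply: is_derive_eq.
  rewrite /GRing.scale /= /wronskian /profile /sinhc (negbTE s_neq0).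
  have e := cosh_sqr s.
  by field: e; rewrite s_neq0 sh0.
apply: near_eq_is_derive D.
near=> z; rewrite /profile /sinhc ifF//; apply/negbTE.
by near: z; exact: open_neq.
Unshelve. all: by end_near. Qed.

End Profile.

(** * Complex exponential and polar coordinates *)

Section ComplexTopology.
Context {R : realType}.
Implicit Types z w : R[i].

Lemma normcE z : `|z| = (Normc.normc z)%:C.
Proof. by case: z. Qed.

Lemma normc_eq1 z : `|z| = 1 <-> Normc.normc z = 1.
Proof. by rewrite normcE; split=> [/complexI|->]. Qed.

Lemma normc_lt1 z : (`|z| < 1) = (Normc.normc z < 1).
Proof. by rewrite normcE -[1]/(1%:C) ltcR. Qed.

Lemma normc_le1 z : (`|z| <= 1) = (Normc.normc z <= 1).
Proof. by rewrite normcE -[1]/(1%:C) lecR. Qed.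

Lemma normc_sqr z : Normc.normc z ^+ 2 = complex.Re z ^+ 2 + complex.Im z ^+ 2.
Proof. by case: z => x y /=; rewrite sqr_sqrtr// addr_ge0 ?sqr_ge0. Qed.

Lemma normc_ge0 z : 0 <= Normc.normc z.
Proof. by case: z => x y; exact: sqrtr_ge0. Qed.

Lemma normRe_le z : `|complex.Re z| <= Normc.normc z.
Proof.
rewrite -(ler_pXn2r (n := 2))// ?nnegrE ?normc_ge0// normc_sqr.
by rewrite real_normK ?num_real// lerDl sqr_ge0.
Qed.

Lemma normIm_le z : `|complex.Im z| <= Normc.normc z.
Proof.
rewrite -(ler_pXn2r (n := 2))// ?nnegrE ?normc_ge0// normc_sqr.
by rewrite real_normK ?num_real// lerDr sqr_ge0.
Qed.

Lemma normc_le_ReIm z :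
  Normc.normc z <= `|complex.Re z| + `|complex.Im z|.
Proof.
rewrite -(ler_pXn2r (n := 2))// ?nnegrE ?normc_ge0 ?addr_ge0// normc_sqr.
rewrite sqrrD !real_normK ?num_real// lerD2r lerDl.
by rewrite mulrn_wge0// mulr_ge0.
Qed.

Lemma cvg_complexP {T : Type} (F : set_system T) {FF : Filter F}
    (f : T -> plane R) (z : plane R) :
  f @ F --> z <-> (complex.Re (f x) @[x --> F] --> complex.Re z) /\
                  (complex.Im (f x) @[x --> F] --> complex.Im z).
Proof.
split=> [/cvgrPdist_lt fz|[/cvgrPdist_lt fr /cvgrPdist_lt fi]].
  split; apply/cvgrPdist_lt => e e0;
  have := fz e%:C; rewrite -[0]/(0%:C) ltcR => /(_ e0); apply: filterS => x;
  rewrite normcE ltcR; apply: le_lt_trans => /=.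
  - by have := normRe_le (z - f x); rewrite !raddfB.
  - by have := normIm_le (z - f x); rewrite !raddfB.
apply/cvgrPdist_lt => -[e i]; rewrite ltcE/= => /andP[/eqP ->] e0.
have e20 : 0 < e / 2 by rewrite divr_gt0.
near=> x.
rewrite normcE ltcR (le_lt_trans (normc_le_ReIm _))//.
rewrite [ltRHS](splitr e) ltrD// !raddfB/=; near: x.
- exact: fr.
- exact: fi.
Unshelve. all: by end_near. Qed.

Section Filtered.
Context {T : Type} (F : set_system T) {FF : Filter F}.
Implicit Types (f g : T -> plane R) (a b : plane R).

Lemma cvg_Re f a : f @ F --> a -> complex.Re (f x) @[x --> F] --> complex.Re a.
Proof. by move/cvg_complexP => -[]. Qed.

Lemma cvg_Im f a : f @ F --> a -> complex.Im (f x) @[x --> F] --> complex.Im a.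
Proof. by move/cvg_complexP => -[]. Qed.

Lemma cvgDC f g a b : f @ F --> a -> g @ F --> b ->
  (fun x => f x + g x) @ F --> a + b.
Proof. exact: (@cvgD R[i] (plane R)). Qed.

Lemma cvgBC f g a b : f @ F --> a -> g @ F --> b ->
  (fun x => f x - g x) @ F --> a - b.
Proof. exact: (@cvgB R[i] (plane R)). Qed.

Lemma cvgMC f g a b : f @ F --> a -> g @ F --> b ->
  (fun x => f x * g x : plane R) @ F --> (a * b : plane R).
Proof. exact: (@cvgM R[i]). Qed.

Lemma cvgVC f a : a != 0 -> f @ F --> a ->
  (fun x => (f x)^-1 : plane R) @ F --> (a^-1 : plane R).
Proof. exact: (@cvgV R[i]). Qed.

Lemma cvg_normc f a : f @ F --> a ->
  Normc.normc (f x) @[x --> F] --> Normc.normc a.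
Proof.
have -> : @Normc.normc R = fun z =>
  Num.sqrt (complex.Re z ^+ 2 + complex.Im z ^+ 2) by apply/funext => -[].
move=> fa.
apply: (@continuous_cvg _ _ _ _ _ _ Num.sqrt); first exact: sqrt_continuous.
apply: cvgD; apply: (@continuous_cvg _ _ _ _ _ _ (fun x : R => x ^+ 2));
  by [exact: exprn_continuous|exact: cvg_Re|exact: cvg_Im].
Qed.

Lemma cvg_expC f a : f @ F --> a -> (expC (f x) : plane R) @[x --> F] --> (expC a : plane R).
Proof.
move=> fa; have cr : expR (complex.Re (f x)) @[x --> F] --> expR (complex.Re a).
  by apply: (@continuous_cvg _ _ _ _ _ _ expR); [exact: continuous_expR|exact: cvg_Re].
apply/cvg_complexP; split => /=; apply: cvgM => //.
- by apply: (@continuous_cvg _ _ _ _ _ _ cos); [exact: continuous_cos|exact: cvg_Im].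
- by apply: (@continuous_cvg _ _ _ _ _ _ sin); [exact: continuous_sin|exact: cvg_Im].
Qed.

Lemma cvg_f_t (t : R) f a : a != 1 -> f @ F --> a ->
  (f_t t (f x) : plane R) @[x --> F] --> (f_t t a : plane R).
Proof.
move=> a1 fa.
apply: (cvgMC fa).
apply: cvg_expC.
apply: cvgMC; first exact: cvg_cst.
have cst1 : (fun=> 1 : plane R) @ F --> (1 : plane R) by exact: cvg_cst.
apply: (cvgMC (cvgDC cst1 fa)).
apply: cvgVC; first by rewrite subr_eq0 eq_sym.
exact: (cvgBC cst1 fa).
Qed.

Lemma cvg_cis (f : T -> R) (a : R) : f @ F --> a ->
  (cis (f x) : plane R) @[x --> F] --> (cis a : plane R).
Proof.
move=> fa; apply/cvg_complexP; split => /=.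
- by apply: (@continuous_cvg _ _ _ _ _ _ cos) => //; exact: continuous_cos.
- by apply: (@continuous_cvg _ _ _ _ _ _ sin) => //; exact: continuous_sin.
Qed.

End Filtered.

Lemma continuous_cis : continuous (@cis R : R -> plane R).
Proof. by move=> x; apply: cvg_cis; exact: cvg_id. Qed.

Lemma expCD (z w : R[i]) : expC (z + w) = expC z * expC w.
Proof.
case: z w => [a b] [c d]; rewrite /expC /= expRD cosD sinD.
by apply/eqP; rewrite eq_complex/=; apply/andP; split; apply/eqP; ring.
Qed.

Lemma expC0 : expC 0 = 1 :> R[i].
Proof. by rewrite /expC /= expR0 cos0 sin0 mulr1 mulr0. Qed.

Lemma normc_expC z : Normc.normc (expC z) = expR (complex.Re z).
Proof.
rewrite /expC /=.
have -> : (expR (complex.Re z) * cos (complex.Im z)) ^+ 2 +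
  (expR (complex.Re z) * sin (complex.Im z)) ^+ 2 = expR (complex.Re z) ^+ 2.
  by rewrite !exprMn -mulrDr cos2Dsin2 mulr1.
by rewrite sqrtr_sqr ger0_norm// expR_ge0.
Qed.

Lemma expC_neq0 z : expC z != 0.
Proof.
apply/eqP => e; have := normc_expC z; rewrite e Normc.normc0 => /eqP.
by rewrite lt_eqF// expR_gt0.
Qed.

Lemma cisE (x : R) : cis x = expC (0 +i* x).
Proof. by rewrite /expC/= expR0 !mul1r. Qed.

Lemma expC_polar (s x : R) : expC (s +i* x) = (expR s)%:C * cis x.
Proof. by rewrite /expC /cis; simpc. Qed.

Lemma normc_cis (x : R) : Normc.normc (cis x) = 1.
Proof. by rewrite cisE normc_expC/= expR0. Qed.

Lemma unit_polar (a b : R) : a ^+ 2 + b ^+ 2 = 1 ->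
  exists2 x, x \in `]- pi, pi] & cis x = a +i* b.
Proof.
move=> ab; have a1 : -1 <= a <= 1 by apply/andP; split; nra.
have ca : cos (acos a) = a by rewrite acosK// in_itv.
have sa : sin (acos a) = `|b|.
  by rewrite sin_acos// -ab addrAC subrr add0r sqrtr_sqr.
have a0 := acos_ge0 a1; have api := acos_lepi a1; have p0 := @pi_gt0 R.
have [b0|b0] := leP 0 b.
  exists (acos a); first by rewrite in_itv/= api andbT; lra.
  by rewrite /cis ca sa ger0_norm.
exists (- acos a); last by rewrite /cis cosN sinN ca sa ltr0_norm// opprK.
rewrite in_itv/= ltrN2; apply/andP; split; last lra.
rewrite lt_neqAle api andbT; apply: contraTneq b0 => e.
by move: sa; rewrite e sinpi => /esym/normr0_eq0 ->; rewrite ltxx.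
Qed.

Lemma polar z : z != 0 ->
  exists2 x, x \in `]- pi, pi] & z = expC (ln (Normc.normc z) +i* x).
Proof.
move=> z0; have n0 : 0 < Normc.normc z.
  rewrite lt_neqAle normc_ge0 andbT eq_sym.
  by apply: contra_neq z0; exact: Normc.eq0_normc.
case: z z0 n0 => a b z0; set r := Normc.normc _ => n0.
have [|x xpi xE] := @unit_polar (a / r) (b / r).
  rewrite !expr_div_n -mulrDl; have -> : a ^+ 2 + b ^+ 2 = r ^+ 2.
    by rewrite normc_sqr.
  by rewrite divff// expf_neq0// gt_eqF.
exists x => //; rewrite expC_polar xE lnK ?posrE//.
by simpc; rewrite !(mulrC r) !divfK// gt_eqF.
Qed.

Lemma cos_eq1 (x : R) : `|x| < pi *+ 2 -> cos x = 1 -> x = 0.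
Proof.
rewrite ltr_norml => /andP[x1 x2] cx.
have c2 : cos (x / 2) ^+ 2 = 1.
  have e : x / 2 *+ 2 = x by rewrite -mulr_natr divfK.
  by have := cos_mulr2n (x / 2); rewrite e cx -mulr_natr; lra.
have s0 : sin (x / 2) = 0.
  by apply/eqP; rewrite -sqrf_eq0 sin2cos2 c2 subrr.
have pi2 : pi *+ 2 = pi * 2 :> R by rewrite mulr_natr.
have [x0|x0|//] := ltgtP x 0.
- have : 0 < sin (- (x / 2)) by apply: sin_gt0_pi; apply/andP; split; lra.
  by rewrite sinN s0 oppr0 ltxx.
- have : 0 < sin (x / 2) by apply: sin_gt0_pi; apply/andP; split; lra.
  by rewrite s0 ltxx.
Qed.

Lemma cis_inj (x y : R) : x \in `]- pi, pi] -> y \in `]- pi, pi] ->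
  cis x = cis y -> x = y.
Proof.
rewrite !in_itv/= => /andP[x1 x2] /andP[y1 y2] [cE sE].
apply/eqP; rewrite -subr_eq0; apply/eqP/cos_eq1.
  rewrite ltr_norml -mulr_natr; apply/andP; split; lra.
by rewrite cosB cE sE -!expr2 cos2Dsin2.
Qed.

End ComplexTopology.

(** * The domain [Sigma_t] *)

Section Modulus.
Context {R : realType}.
Variable t : R.
Implicit Types s x : R.

Lemma cosh_gt1 s : s != 0 -> 1 < cosh s.
Proof.
move=> s0; have sh0 : sinh s != 0.
  have [sl|sg|e] := ltgtP s 0; last by rewrite e eqxx in s0.
  - by rewrite -[s]opprK sinhN oppr_eq0 gt_eqF// sinh_gt0// oppr_gt0.
  - by rewrite gt_eqF// sinh_gt0.
have := cosh_ge1 s; rewrite le_eqVlt => /predU1P[e|//].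
have : sinh s ^+ 2 = 0 by have := cosh_sqr s; rewrite -e; lra.
by move/eqP; rewrite sqrf_eq0 (negbTE sh0).
Qed.

Lemma coshBcos_gt0 s x : (s != 0) || (cos x != 1) -> 0 < cosh s - cos x.
Proof.
move=> /orP[/cosh_gt1|]; first by have := cos_le1 x; lra.
have := cosh_ge1 s; have := cos_le1 x; rewrite le_eqVlt => /predU1P[->|]; last lra.
by rewrite eqxx.
Qed.

Lemma expC_neq1 s x : cosh s - cos x != 0 -> expC (s +i* x) != 1.
Proof.
apply: contra_neq => e; have := normc_expC (s +i* x).
rewrite e Normc.normc1 /= => /esym s0.
have {}s0 : s = 0 by apply: expR_inj; rewrite s0 expR0.
move: e; rewrite s0 cosh0 /expC /= expR0 !mul1r => -[-> _].
by rewrite subrr.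
Qed.

(** Since [|1 - exp (s + i x)|^2 = 2 exp s (cosh s - cos x)], the fraction in the exponent has real
    part [- sinh s / (cosh s - cos x)] and imaginary part [sin x / (cosh s - cos x)]; the former
    combines with the factor [exp s] into [profile]. *)
Lemma f_t_expC s x : cosh s - cos x != 0 ->
  f_t t (expC (s +i* x)) =
  expC ((s / (cosh s - cos x) * (profile t s - cos x))
        +i* (x + t / 2 * (sin x / (cosh s - cos x)))).
Proof.
move=> D0; have l1 := expC_neq1 D0.
have E : (1 + expC (s +i* x)) / (1 - expC (s +i* x)) =
    (- sinh s / (cosh s - cos x)) +i* (sin x / (cosh s - cos x)).
  apply: (canLR (mulfK _)); first by rewrite subr_eq0 eq_sym.
  apply/eqP; rewrite eq_complex/=.
  have sc := sin2cos2 x; have cs := cosh_sqr s; have es := expR_cosh_sinh s.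
  apply/andP; split; apply/eqP; rewrite !es; field: sc cs; exact: D0.
rewrite /f_t E -expCD; congr expC.
have ps : s * profile t s = s * cosh s - t / 2 * sinh s.
  rewrite /profile /sinhc; case: eqVneq => [->|s0]; first by rewrite sinh0; ring.
  by field.
apply/eqP; rewrite eq_complex/=; apply/andP; split; apply/eqP; last by field.
rewrite [RHS]mulrAC mulrBr ps.
by field.
Qed.

Lemma normc_f_t s x : cosh s - cos x != 0 ->
  Normc.normc (f_t t (expC (s +i* x))) =
  expR (s / (cosh s - cos x) * (profile t s - cos x)).
Proof. by move=> D0; rewrite f_t_expC// normc_expC. Qed.

Lemma f_t0 : f_t t 0 = 0.
Proof. by rewrite /f_t mul0r. Qed.

Lemma normc_f_t_unit (z : R[i]) : Normc.normc z = 1 -> Normc.normc (f_t t z) = 1.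
Proof.
move=> z1; have z0 : z != 0.
  by apply: contra_eq_neq z1 => ->; rewrite Normc.normc0 eq_sym oner_neq0.
have [x _ zE] := polar z0; rewrite z1 ln1 in zE.
have [c1|c1] := eqVneq (cos x) 1; last first.
  by rewrite zE normc_f_t ?mul0r ?expR0// gt_eqF// coshBcos_gt0// c1 orbT.
(* At 1 division by zero makes the exponent vanish, so the modulus is 1 there as well. *)
have -> : z = 1.
  rewrite zE /expC/= expR0 !mul1r c1; have := cos2Dsin2 x.
  rewrite c1 expr1n => /eqP; rewrite -subr_eq0 addrAC subrr add0r sqrf_eq0.
  by move=> /eqP ->.
by rewrite /f_t subrr invr0 !mulr0 expC0 mulr1 Normc.normc1.
Qed.

Lemma F_t0 : ~ F_t t 0.
Proof. by case=> _; rewrite f_t0 normr0 => /eqP; rewrite eq_sym oner_eq0. Qed.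

Lemma F_tE s x : F_t t (expC (s +i* x)) <-> s != 0 /\ profile t s = cos x.
Proof.
rewrite /F_t/=.
have nE : (`|expC (s +i* x)| != 1) = (s != 0).
  congr negb; apply/eqP/eqP; rewrite normc_eq1 normc_expC/=.
    by move=> e; apply: expR_inj; rewrite e expR0.
  by move=> ->; rewrite expR0.
rewrite nE; split => -[s0]; have D0 := coshBcos_gt0 (introT orP (or_introl s0));
  have D0' := lt0r_neq0 (D0 x).
- move=> /normc_eq1; rewrite normc_f_t// -expR0 => /expR_inj/eqP.
  by rewrite !mulf_eq0 (negbTE s0) invr_eq0 (negbTE D0')/= subr_eq0 => /eqP.
- move=> h; split; first exact: s0.
  apply/normc_eq1; rewrite normc_f_t// h.
  by rewrite subrr mulr0 expR0.
Qed.

Lemma closure_cvg {T U : topologicalType} (F : set_system T) {FF : ProperFilter F}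
    (A : set U) (u : T -> U) (y : U) :
  (\forall x \near F, A (u x)) -> u @ F --> y -> closure A y.
Proof.
move=> uA uy B /uy uB; have [x [Ax Bx]] := filter_ex (filterI uA uB).
by exists (u x).
Qed.

Section Gauge.
Local Notation maxr := Num.max.
Variable M : R.
Hypothesis profileM : forall s, M <= s -> 1 < profile t s.

(* In polar coordinates [z = exp (s + i x)] this has the sign of
   [profile t s - cos x]; the truncation at radius [exp (- M)] only serves to
   make it continuous at the origin. *)
Definition gauge (z : plane R) : R :=
  profile t (ln (maxr (Normc.normc z) (expR (- M)))) -
  complex.Re z / maxr (Normc.normc z) (expR (- M)).

Lemma cvg_gauge {T : Type} (F : set_system T) {FF : Filter F}
    (f : T -> plane R) (z : plane R) :
  f @ F --> z -> gauge (f x) @[x --> F] --> gauge z.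
Proof.
have max_gt0 (w : R[i]) : 0 < maxr (Normc.normc w) (expR (- M)).
  by rewrite lt_max expR_gt0 orbT.
move=> fz; rewrite /gauge.
have cm : maxr (Normc.normc (f x)) (expR (- M)) @[x --> F] -->
    maxr (Normc.normc z) (expR (- M)).
  apply: (@continuous_cvg _ _ _ _ _ _ (fun x : R => maxr x (expR (- M)))).
    by apply: continuous_max; [exact: cvg_id|exact: cvg_cst].
  exact: cvg_normc.
apply: cvgB.
  apply: (@continuous_cvg _ _ _ _ _ _ (profile t)); first exact: continuous_profile.
  by apply: (@continuous_cvg _ _ _ _ _ _ (@ln R)) => //; exact: continuous_ln.
by apply: cvgM; [exact: cvg_Re|apply: cvgV => //; rewrite gt_eqF].
Qed.

Lemma continuous_gauge : continuous gauge.
Proof. by move=> z; apply: (@cvg_gauge _ (nbhs z) _ id); exact: cvg_id. Qed.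

Lemma gauge0 : 0 < gauge 0.
Proof.
rewrite /gauge Normc.normc0 mul0r subr0 max_r ?expR_ge0// expRK profileN.
exact: lt_trans (profileM (lexx M)).
Qed.

(** The truncation acts only for [s <= - M], where [profile] exceeds 1 and both quantities are
    therefore positive. *)
Lemma gauge_expC s x : gauge (expC (s +i* x)) = profile t s - cos x \/
  0 < gauge (expC (s +i* x)) /\ 0 < profile t s - cos x.
Proof.
rewrite /gauge normc_expC /=; have [sM|Ms] := leP (expR s) (expR (- M)).
  right; rewrite expRK profileN; have p1 := profileM (lexx M).
  have p2 : 1 < profile t s.
    rewrite -profileN; apply: profileM.
    by rewrite lerNr -ler_expR.
  have := cos_le1 x; split; last by lra.
  have : expR s * cos x / expR (- M) <= 1.
    rewrite ler_pdivrMr ?expR_gt0// mul1r (le_trans _ sM)//.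
    by rewrite ler_piMr// expR_ge0.
  by lra.
by left; rewrite expRK mulrAC divff ?mul1r// gt_eqF// expR_gt0.
Qed.

Lemma gauge_lt0 s x : (gauge (expC (s +i* x)) < 0) = (profile t s < cos x).
Proof.
have [->|[g p]] := gauge_expC s x; first by rewrite subr_lt0.
by rewrite ltNge (ltW g) -subr_lt0 [RHS]ltNge (ltW p).
Qed.

Lemma gauge_eq0 s x : (gauge (expC (s +i* x)) == 0) = (profile t s == cos x).
Proof.
have [->|[g p]] := gauge_expC s x; first by rewrite subr_eq0.
by rewrite gt_eqF// -subr_eq0 gt_eqF.
Qed.

Lemma polar_gauge_le0 z : gauge z <= 0 ->
  exists s x, x \in `]- pi, pi] /\ z = expC (s +i* x).
Proof.
have [->|z0] := eqVneq z 0; first by rewrite leNgt gauge0.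
by move=> _; have [x xpi ->] := polar z0; exists (ln (Normc.normc z)), x.
Qed.

Lemma closed_gauge0 : closed [set z | gauge z = 0].
Proof.
rewrite (_ : mkset _ = gauge @^-1` [set 0]); last by apply/seteqP; split.
by apply: closed_comp => // z _; exact: continuous_gauge.
Qed.

Lemma F_t_gauge : F_t t `<=` [set z | gauge z = 0].
Proof.
move=> z Fz; have [z0|z0] := eqVneq z 0; first by move: Fz; rewrite z0 => /F_t0.
have [x _ zE] := polar z0; move: Fz; rewrite zE => /F_tE[_ /eqP h].
by apply/eqP; rewrite gauge_eq0.
Qed.

(* The points of the unit circle with [cos x = 1 - t / 2] are limits of points of
   [F_t] with [ln |z| = u > 0] and argument of cosine [profile t u]. *)
Lemma closure_F_t_unit x : 0 < t -> profile t 0 = cos x ->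
  closure (F_t t) (expC (0 +i* x)).
Proof.
move=> t0 hx; have h01 : profile t 0 < 1 by rewrite profile0; lra.
pose b : R := if 0 <= sin x then 1 else -1.
pose g (u : R) : plane R := (expR u * profile t u) +i*
  (expR u * (b * Num.sqrt (1 - profile t u ^+ 2))).
have cp := @continuous_profile R t 0.
have g0 : g 0 = expC (0 +i* x).
  rewrite /g /expC/= hx -sin2cos2 sqrtr_sqr /b.
  by case: ger0P => _; rewrite ?mul1r ?mulrNN ?mul1r.
have cg : g @ (0 : R) --> (g 0 : plane R).
  apply/cvg_complexP; split => /=.
    by apply: cvgM => //; exact: continuous_expR.
  apply: cvgM; first exact: continuous_expR.
  apply: cvgM; first exact: cvg_cst.
  apply: (@continuous_cvg _ _ _ _ _ _ Num.sqrt); first exact: sqrt_continuous.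
  apply: cvgB; first exact: cvg_cst.
  apply: (@continuous_cvg _ _ _ _ _ _ (fun x : R => x ^+ 2)) => //.
  exact: exprn_continuous.
rewrite -g0; apply: (@closure_cvg _ _ (0:R)^'+ _ _ g).
  near=> u; have u0 : 0 < u by [].
  have pu1 : profile t u < 1 by near: u; exact: (cvgr_lt _ (cvg_at_right_filter cp) _ h01).
  (* A value at most -1 at [u > 0] would force [profile t 0 < -1], whereas [profile t 0] is a
     cosine. *)
  have pu2 : - 1 < profile t u.
    rewrite ltNge; apply/negP => h.
    have := profile_lt_lt (lexx 0) u0 (lexx (-1)) h.
    by rewrite hx ltNge cos_geN1.
  have [y _ yE] : exists2 y, y \in `]- pi, pi] &
      cis y = profile t u +i* (b * Num.sqrt (1 - profile t u ^+ 2)).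
    apply: unit_polar; rewrite exprMn sqr_sqrtr.
      by rewrite /b; case: ifP => _; rewrite ?sqrrN expr1n; ring.
    by rewrite -[1](expr1n _ 2) subr_sqr mulr_ge0//; lra.
  have -> : g u = expC (u +i* y) by rewrite expC_polar yE /g; simpc.
  by case: yE => cy _; apply/F_tE; rewrite gt_eqF.
apply: cvg_at_right_filter; exact: cg.
Unshelve. all: by end_near. Qed.

(** Off the unit circle the zeros of [gauge] are exactly [F_t]; those on the circle are the points
    that the closure adds. *)
Lemma E_tE : 0 < t -> E_t t = [set z | gauge z = 0].
Proof.
move=> t0; apply/seteqP; split.
  rewrite /E_t; have := closed_gauge0 => /closure_id ->.
  exact: closureS F_t_gauge.
move=> z /= gz; have gz0 : gauge z <= 0 by rewrite gz.
have [s [x [_ zE]]] := polar_gauge_le0 gz0.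
move/eqP: gz; rewrite zE gauge_eq0 => /eqP h.
have [s0|s0] := eqVneq s 0.
  by rewrite s0; apply: closure_F_t_unit; rewrite // -s0.
by apply: subset_closure; apply/F_tE.
Qed.

(** The region is star-shaped about 0 in the coordinates [(s, x)]: shrinking [|s|] keeps [profile]
    below the level, and shrinking [|x| <= pi] raises the cosine. *)
Lemma gauge_lt0_log_convex s x u : x \in `]- pi, pi] -> 0 <= u <= 1 ->
  profile t s < cos x -> profile t (u * s) < cos (u * x).
Proof.
rewrite in_itv/= => /andP[x1 x2] /andP[u0 u1] h.
have h1 : profile t (u * s) < cos x.
  move: h; have [->|s0 h] := eqVneq s 0; first by rewrite mulr0.
  move: u1; rewrite le_eqVlt => /predU1P[->|u1]; first by rewrite mul1r.
  rewrite -profile_norm; apply: (@profile_lt_lt _ t _ `|s|).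
  - exact: normr_ge0.
  - by rewrite normrM (ger0_norm u0) gtr_pMl// normr_gt0.
  - exact: cos_geN1.
  - by rewrite profile_norm ltW.
apply: lt_le_trans h1 _.
have xpi : `|x| <= pi by rewrite ler_norml x2 andbT ltW.
rewrite -[leLHS]cos_norm -[leRHS]cos_norm normrM (ger0_norm u0).
have hx : `|x| \in `[0, pi] by rewrite in_itv/= normr_ge0.
have hux : u * `|x| \in `[0, pi].
  by rewrite in_itv/= mulr_ge0//= (le_trans _ xpi)// ler_piMl.
by rewrite leNgt ltr_cos// -leNgt ler_piMl.
Qed.

(** A connected set through 1 that avoids the zeros of [gauge] meets [gauge < 0] in a relatively
    clopen part, hence lies in it. Conversely the spiral [u -> exp (u (s + i x))] joins 1 to any
    point with [gauge < 0] inside that set. *)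
Lemma Sigma_tE : 0 < t -> Sigma_t t = [set z | gauge z < 0].
Proof.
move=> t0; rewrite /Sigma_t E_tE//; apply/seteqP; split.
  move=> z [C [C1 CE Cc] Cz].
  suff CW : C `&` [set z | gauge z < 0] = C by move: Cz; rewrite -CW => -[].
  apply: Cc.
  - exists 1; split => //=; have -> : (1 : R[i]) = expC (0 +i* 0) by rewrite expC0.
    by rewrite gauge_lt0 cos0 profile0; lra.
  - exists [set z | gauge z < 0] => //.
    rewrite (_ : mkset _ = gauge @^-1` [set x | x < 0]) //.
    by apply: open_comp => // w _; exact: continuous_gauge.
  - exists [set z | gauge z <= 0].
      rewrite (_ : mkset _ = gauge @^-1` [set x | x <= 0]) //.
      by apply: closed_comp => // w _; exact: continuous_gauge.
    apply/seteqP; split => w /= [Cw gw]; split => //; first exact: ltW.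
    by rewrite lt_neqAle gw andbT; apply/eqP => gw0; exact: CE Cw gw0.
move=> z /= gz; have [s [x [xpi zE]]] := polar_gauge_le0 (ltW gz).
pose path (u : R) : plane R := expC ((u * s) +i* (u * x)).
have cpath : continuous path.
  move=> u; apply: cvg_expC; apply/cvg_complexP.
  by split=> /=; apply: cvgMr_tmp; exact: cvg_id.
apply: (@connected_component_max _ _ (path @` `[0, 1])).
- by exists 0; [rewrite /= in_itv/= lexx ler01|rewrite /path !mul0r expC0].
- move=> _ [u /= u01 <-] /eqP; apply/negP; rewrite lt_eqF// gauge_lt0.
  by rewrite gauge_lt0_log_convex// -gauge_lt0 -zE.
- apply: connected_continuous_connected; first exact: segment_connected.
  exact: continuous_subspaceT.
- by exists 1; [rewrite /= in_itv/= lexx ler01|rewrite /path !mul1r].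
Qed.

End Gauge.

Hypothesis t_gt0 : 0 < t.

Lemma Sigma_t_polar (r x : R) : 0 < r ->
  Sigma_t t (r%:C * cis x) <-> profile t (ln r) < cos x.
Proof.
move=> r0; have [M _ hM] := profile_large t_gt0.
rewrite (Sigma_tE hM t_gt0)/= -{1}(lnK (x := r))// -expC_polar.
by rewrite (gauge_lt0 hM).
Qed.

Lemma radiiE (x : R) :
  radii t x = [set r | 0 < r /\ profile t (ln r) < cos x].
Proof.
by apply/seteqP; split => r /= [r0 h]; split => //; apply/Sigma_t_polar.
Qed.

(** The periodic version of [angles], not cut at [pi]: an open set, so that derivatives make sense
    at [pi] too. *)
Definition open_angles : set R := [set x | profile t 0 < cos x].

Lemma anglesE :
  angles t = [set x | x \in `]- pi, pi]] `&` open_angles.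
Proof.
apply/seteqP; split => x /=; rewrite /angles/= radiiE => -[xpi].
- move=> [r /= [r0 h]]; split; rewrite // /open_angles /=.
  have [r1|r1] := eqVneq (ln r) 0; first by rewrite -{1}r1.
  apply: (@profile_lt_lt _ t 0 `|ln r|) => //; first by rewrite normr_gt0.
  + exact: cos_geN1.
  + by rewrite profile_norm ltW.
- by move=> h; split => //; exists 1; rewrite /= ln1.
Qed.

Lemma r_tP (x : R) : open_angles x ->
  exists S, [/\ 0 < S, profile t S = cos x & r_t t x = expR S].
Proof.
move=> h; have [S S0 hS] := profile_surj t_gt0 (cos_le1 x) h.
exists S; split => //; rewrite /r_t radiiE.
have -> : [set r | 0 < r /\ profile t (ln r) < cos x] =
    [set` `]expR (- S), expR S[].
  apply/seteqP; split => r /=; rewrite in_itv/=.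
    move=> [r0]; rewrite (profile_ltE _ S0 (cos_geN1 x) hS) ltr_norml.
    by rewrite -[r in _ < r < _]lnK// !ltr_expR.
  move=> /andP[r1 r2]; have r0 := lt_trans (expR_gt0 _) r1; split => //.
  rewrite (profile_ltE _ S0 (cos_geN1 x) hS) ltr_norml.
  by rewrite -(ltr_expR (- S)) -(ltr_expR (ln r)) lnK// r1.
by rewrite sup_itv// bnd_simp ltr_expR; lra.
Qed.

End Modulus.

(** * Implicit differentiation of a continuous solution *)

Lemma near_eq_continuous {T U : topologicalType} (f g : T -> U) (x : T) :
  (\near x, f x = g x) -> {for x, continuous f} -> {for x, continuous g}.
Proof.
move=> fg; rewrite /prop_for /continuous_at -(nbhs_singleton fg) => fx.
by apply: cvg_trans fx; apply: near_eq_cvg; apply: filterS fg.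
Qed.

(** Caratheodory slopes [q] of [F] and [p] of [F \o g] satisfy [q (g y) (g y - g x) = p y (y - x)],
    so [p / (q \o g)] is a slope of [g]. *)
Lemma is_derive_implicit {R : realType} (F g : R -> R) (x dF dC : R) :
  {for x, continuous g} -> is_derive (g x) 1 F dF -> dF != 0 ->
  is_derive x 1 (F \o g) dC -> is_derive x 1 g (dC / dF).
Proof.
move=> cg /is_derive1_caratheodory[q [qE cq qx]] dF0.
move=> /is_derive1_caratheodory[p [pE cp px]]; apply/is_derive1_caratheodory.
(* The first branch makes the slope identity hold for every [y]; near [x] only the second one
   occurs. *)
pose G y := if q (g y) == 0 then (g y - g x) / (y - x) else p y / q (g y).
exists G; split.
- move=> y; rewrite /G; have eqy := qE (g y); have epy := pE y.
  rewrite /= eqy in epy; case: eqVneq => [q0|q0].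
    have [->|yx] := eqVneq y x; first by rewrite !subrr mulr0.
    by rewrite divfK// subr_eq0.
  by rewrite mulrAC -epy mulrAC divff ?mul1r.
- have cqg : q (g y) @[y --> x] --> q (g x).
    by apply: continuous_cvg => //; exact: cg.
  have qgx : q (g x) != 0 by rewrite qx.
  apply: (@near_eq_continuous _ _ (fun y => p y / q (g y))).
    near=> y; rewrite /G ifF//; apply/negbTE; near: y.
    by apply: (cvgr_neq0 _ cqg).
  have : p y / q (g y) @[y --> x] --> p x / q (g x).
    by apply: cvgM => //; exact: cvgV.
  by [].
- by rewrite /G qx (negbTE dF0) px.
Unshelve. all: by end_near. Qed.

(** * The boundary angle map and the density [a_t] *)

Section Phase.
Context {R : realType}.
Variable t : R.
Implicit Types x s : R.

Local Notation A := (open_angles t).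

Lemma open_open_angles : open A.
Proof.
rewrite (_ : A = (@cos R) @^-1` [set y | profile t 0 < y])//.
by apply: open_comp => // x _; exact: continuous_cos.
Qed.

Lemma near_open_angles x : A x -> \forall y \near x, A y.
Proof. by move=> Ax; apply: open_nbhs_nbhs; split=> //; exact: open_open_angles. Qed.

Definition log_r x : R := ln (r_t t x).

Lemma log_rP x : 0 < t -> A x ->
  [/\ 0 < log_r x, profile t (log_r x) = cos x & r_t t x = expR (log_r x)].
Proof.
by move=> t0 /(r_tP t0)[S [S0 hS rE]]; rewrite /log_r rE expRK.
Qed.

(** The strict inequalities [profile (S - d) < cos x < profile (S + d)] persist for nearby angles
    and trap the crossing between [S - d] and [S + d]; [d <= S] keeps [S - d] in the range
    [s >= 0]. *)
Lemma continuous_log_r x : 0 < t -> A x -> {for x, continuous log_r}.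
Proof.
move=> t0 Ax; have [S0 hS _] := log_rP t0 Ax; set S := log_r x in S0 hS *.
apply/cvgrPdist_lt => e e0.
pose d := Num.min e S; have d0 : 0 < d by rewrite lt_min e0 S0.
have dS : 0 <= S - d by rewrite subr_ge0 ge_min lexx orbT.
have h1 : profile t (S - d) < cos x.
  by rewrite (profile_ltE _ S0 (cos_geN1 x) hS) ger0_norm//; lra.
have h2 : cos x < profile t (S + d).
  rewrite ltNge; apply/negP => h.
  have := profile_lt_lt (ltW S0) _ (cos_geN1 x) h.
  by rewrite hS ltxx => H; suff : false by []; apply: H; lra.
have cc := @continuous_cos R x.
near=> y; have Ay : A y by near: y; exact: near_open_angles.
have [T0 hT _] := log_rP t0 Ay; set T := log_r y in T0 hT *.
have l1 : profile t (S - d) < cos y by near: y; exact: (cvgr_gt _ cc _ h1).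
have l2 : cos y < profile t (S + d) by near: y; exact: (cvgr_lt _ cc _ h2).
have de : d <= e by rewrite ge_min lexx.
clearbody d.
move: l1; rewrite (profile_ltE _ T0 (cos_geN1 y) hT) ger0_norm// => l1.
have l3 : T < S + d.
  rewrite ltNge; apply/negP => ST.
  have Sd0 : 0 <= S + d by lra.
  move: ST; rewrite le_eqVlt => /predU1P[ST|ST].
    by move: l2; rewrite ST hT ltxx.
  have := @profile_lt_lt _ t _ _ _ Sd0 ST (cos_geN1 y); rewrite hT lexx => /(_ isT).
  by move=> /(lt_trans l2); rewrite ltxx.
by rewrite -/S ltr_norml; apply/andP; split; lra.
Unshelve. all: by end_near. Qed.

Definition dlog_r x : R :=
  - sin x * (log_r x * sinh (log_r x)) / wronskian (log_r x) (cos x).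

Lemma is_derive_log_r x : 0 < t -> A x -> is_derive x 1 log_r (dlog_r x).
Proof.
move=> t0 Ax; have [S0 hS _] := log_rP t0 Ax.
have W0 := wronskian_gt0 S0 (cos_geN1 x).
have D := is_derive_profile t S0; rewrite hS in D.
have -> : dlog_r x = - sin x /
    (wronskian (log_r x) (cos x) / (log_r x * sinh (log_r x))).
  by rewrite invf_div mulrA.
apply: (is_derive_implicit (continuous_log_r t0 Ax) D).
  by rewrite mulf_neq0// ?invr_eq0 gt_eqF// mulr_gt0// sinh_gt0.
apply: near_eq_is_derive (is_derive_cos x).
near=> y; have Ay : A y by near: y; exact: near_open_angles.
by have [] := log_rP t0 Ay.
Unshelve. all: by end_near. Qed.

(* The quantity whose angular derivative enters [w_t]. *)
Definition cauchy_im x : R :=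
  2 * r_t t x * sin x / (r_t t x ^+ 2 + 1 - 2 * r_t t x * cos x).

Definition phase x : R := x + t / 2 * cauchy_im x.

Lemma cauchy_imE x : 0 < t -> A x ->
  cauchy_im x = sin x / (cosh (log_r x) - cos x).
Proof.
move=> t0 Ax; have [S0 hS rE] := log_rP t0 Ax; rewrite /cauchy_im rE.
set S := log_r x in S0 hS *.
have D0 : cosh S - cos x != 0 by rewrite gt_eqF// coshBcos_gt0// gt_eqF.
have -> : expR S ^+ 2 + 1 - 2 * expR S * cos x =
    2 * expR S * (cosh S - cos x).
  have e : expR S * expR (- S) = 1 by rewrite -expRD subrr expR0.
  by rewrite /cosh; field: e.
by field; rewrite D0 gt_eqF ?expR_gt0.
Qed.

Lemma coshBcosE x : 0 < t -> A x ->
  cosh (log_r x) - cos x = t / 2 * (sinh (log_r x) / log_r x).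
Proof.
move=> t0 Ax; have [S0 hS rE] := log_rP t0 Ax.
by rewrite -[in LHS]hS /profile /sinhc (gt_eqF S0); ring.
Qed.

(** The boundary equation eliminates the explicit [t], which leaves an expression whose derivative
    has a readable sign. *)
Lemma phaseE x : 0 < t -> A x ->
  phase x = x + log_r x * sin x / sinh (log_r x).
Proof.
move=> t0 Ax; have [S0 hS rE] := log_rP t0 Ax.
rewrite /phase cauchy_imE// coshBcosE//; congr (_ + _).
have ? := lt0r_neq0 S0; have ? := lt0r_neq0 (sinh_gt0 S0).
have ? := lt0r_neq0 t0; field; exact/and3P.
Qed.

Definition dphase x : R :=
  1 + log_r x * cos x / sinh (log_r x) +
  sin x * dlog_r x * (sinh (log_r x) - log_r x * cosh (log_r x))
    / sinh (log_r x) ^+ 2.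

Lemma is_derive_phase x : 0 < t -> A x -> is_derive x 1 phase (dphase x).
Proof.
move=> t0 Ax; have [S0 hS _] := log_rP t0 Ax.
have DS := is_derive_log_r t0 Ax.
have sh0 := lt0r_neq0 (sinh_gt0 S0).
have Dsh : is_derive x 1 (fun y => sinh (log_r y)) (cosh (log_r x) * dlog_r x).
  exact: is_derive1_comp.
have DV := @is_deriveV _ (fun y => sinh (log_r y)) x _ 1 sh0 Dsh.
have D : is_derive x 1 (fun y => y + log_r y * sin y / sinh (log_r y)) (dphase x).
  by apply: is_derive_eq; rewrite /GRing.scale /= /dphase; field.
apply: near_eq_is_derive D.
near=> y; have Ay : A y by near: y; exact: near_open_angles.
by rewrite phaseE.
Unshelve. all: by end_near. Qed.

(** The first two terms add up to a positive number because [S < sinh S] and [cos x >= -1]. In the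
    third, the [- sin x] of [dlog_r] meets [sin x], and the minus sign is absorbed by
    [sinh S - S cosh S < 0]. *)
Lemma dphase_gt0 x : 0 < t -> A x -> 0 < dphase x.
Proof.
move=> t0 Ax; have [S0 hS _] := log_rP t0 Ax; rewrite /dphase /dlog_r.
set S := log_r x in S0 hS *.
have sh0 := sinh_gt0 S0; have W0 := wronskian_gt0 S0 (cos_geN1 x).
apply: ltr_pwDl.
  have c1 := cos_geN1 x; have := sinh_gt_id S0 => sS.
  have -> : 1 + S * cos x / sinh S = (sinh S + S * cos x) / sinh S.
    by field; rewrite gt_eqF.
  by rewrite divr_gt0//; nra.
have -> : sin x * (- sin x * (S * sinh S) / wronskian S (cos x)) *
    (sinh S - S * cosh S) / sinh S ^+ 2 =
  sin x ^+ 2 * (S * sinh S) * (S * cosh S - sinh S)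
    / (wronskian S (cos x) * sinh S ^+ 2).
  by field; rewrite !gt_eqF.
have ? := sinh_lt_mul_cosh S0.
apply: divr_ge0; last by rewrite mulr_ge0 ?sqr_ge0// ltW.
apply: mulr_ge0; last by rewrite subr_ge0 ltW.
by rewrite mulr_ge0 ?sqr_ge0// mulr_ge0// ltW.
Qed.

Lemma continuous_dphase x : 0 < t -> A x -> {for x, continuous dphase}.
Proof.
move=> t0 Ax; have [S0 hS _] := log_rP t0 Ax.
have cl := continuous_log_r t0 Ax.
have cs : sinh (log_r y) @[y --> x] --> sinh (log_r x).
  apply: (@continuous_cvg _ _ _ _ _ _ sinh) => //.
  by apply/differentiable_continuous/derivable1_diffP.
have cc : cosh (log_r y) @[y --> x] --> cosh (log_r x).
  apply: (@continuous_cvg _ _ _ _ _ _ cosh) => //.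
  by apply/differentiable_continuous/derivable1_diffP.
have csin := @continuous_sin R x; have ccos := @continuous_cos R x.
have sh0 := lt0r_neq0 (sinh_gt0 S0).
have cw : wronskian (log_r y) (cos y) @[y --> x] --> wronskian (log_r x) (cos x).
  apply: cvgD; first by apply: cvgB => //; exact: cvgM.
  by apply: cvgM => //; apply: cvgB => //; exact: cvgM.
have cd : dlog_r y @[y --> x] --> dlog_r x.
  apply: cvgM; last first.
    by apply: cvgV => //; rewrite gt_eqF// wronskian_gt0// cos_geN1.
  by apply: cvgM; [exact: cvgN|exact: cvgM].
apply: cvgD.
  apply: cvgD; first exact: cvg_cst.
  by apply: cvgM; [exact: cvgM|exact: cvgV].
apply: cvgM.
  apply: cvgM; first exact: cvgM.
  by apply: cvgB => //; exact: cvgM.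
apply: cvgV; first by rewrite expf_neq0.
by apply: (@continuous_cvg _ _ _ _ _ _ (fun x : R => x ^+ 2)) => //; exact: exprn_continuous.
Qed.

Lemma a_tE x : 0 < t -> A x -> a_t t x = log_r x / (pi * t) * dphase x.
Proof.
move=> t0 Ax; rewrite /a_t /w_t -/(log_r x) -/cauchy_im.
have Dg : is_derive x 1 cauchy_im ((dphase x - 1) * (2 / t)).
  have DP := is_derive_phase t0 Ax.
  have -> : cauchy_im = fun y => (phase y - y) * (2 / t).
    apply/funext => y; rewrite /phase; field; exact: lt0r_neq0.
  by apply: is_derive_eq; rewrite /GRing.scale /=; ring.
rewrite derive1E derive_val.
have p0 := lt0r_neq0 (@pi_gt0 R); have {}t0 := lt0r_neq0 t0.
by move: (pi : R) p0 => p p0; field; exact/andP.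
Qed.

Lemma a_t_gt0 x : 0 < t -> A x -> 0 < a_t t x.
Proof.
move=> t0 Ax; rewrite a_tE// mulr_gt0 ?dphase_gt0//.
by have [S0 _ _] := log_rP t0 Ax; rewrite divr_gt0// mulr_gt0// pi_gt0.
Qed.

Lemma continuous_a_t x : 0 < t -> A x -> {for x, continuous (a_t t)}.
Proof.
move=> t0 Ax.
apply: (@near_eq_continuous _ _ (fun y => log_r y / (pi * t) * dphase y)).
  near=> y; have Ay : A y by near: y; exact: near_open_angles.
  by rewrite a_tE.
apply: cvgM; last exact: continuous_dphase.
by apply: cvgM; [exact: continuous_log_r|exact: cvg_cst].
Unshelve. all: by end_near. Qed.

(** [profile] and [cosh] are even, so reflection in the unit circle changes neither the modulus 1
    nor the argument. *)
Lemma f_t_phase_inner x : 0 < t -> A x ->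
  f_t t (expC (- log_r x +i* x)) = cis (phase x).
Proof.
move=> t0 Ax; have [S0 hS rE] := log_rP t0 Ax.
have D0 : cosh (log_r x) - cos x != 0 by rewrite gt_eqF// coshBcos_gt0// gt_eqF.
rewrite f_t_expC coshN// profileN hS subrr mulr0 cisE.
by rewrite /phase cauchy_imE.
Qed.

Lemma f_t_phase x : 0 < t -> A x ->
  f_t t ((r_t t x)%:C * cis x) = cis (phase x).
Proof.
move=> t0 Ax; have [S0 hS rE] := log_rP t0 Ax; rewrite rE -expC_polar.
have D0 : cosh (log_r x) - cos x != 0 by rewrite gt_eqF// coshBcos_gt0// gt_eqF.
by rewrite f_t_expC// hS subrr mulr0 cisE /phase cauchy_imE.
Qed.

Lemma f_t_inner_lt1 x s : 0 < t -> A x -> s < - log_r x ->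
  Normc.normc (f_t t (expC (s +i* x))) < 1.
Proof.
move=> t0 Ax sS; have [S0 hS rE] := log_rP t0 Ax.
have s0 : s < 0 by lra.
have D0 : 0 < cosh s - cos x by rewrite coshBcos_gt0// lt_eqF.
rewrite normc_f_t ?gt_eqF// -expR0 ltr_expR.
have h : cos x < profile t s.
  rewrite ltNge; apply/negP => h.
  have := @profile_lt_lt _ t (log_r x) `|s| (cos x) (ltW S0).
  rewrite profile_norm hS ltxx => H; suff : false by [].
  by apply: H => //; [rewrite ltr0_norm//; lra|exact: cos_geN1].
rewrite mulrAC nmulr_rlt0 ?invr_gt0//.
by rewrite nmulr_rlt0 // subr_gt0.
Qed.

End Phase.

(** * The inverse [chi] and Biane's density *)

Section LocalInjectivity.
Context {R : realType}.
Implicit Types z w : R[i].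

Lemma cvg_normc_squeeze {T : Type} (F : set_system T) {FF : Filter F}
    (u : T -> plane R) (w : plane R) (e : T -> R) :
  (\forall x \near F, Normc.normc (u x - w) <= e x) -> e @ F --> (0 : R) ->
  u @ F --> w.
Proof.
move=> ue /cvgrPdist_lt e0; apply/cvgrPdist_lt => -[d i].
rewrite ltcE/= => /andP[/eqP ->] d0; near=> x.
rewrite distrC normcE ltcR.
have h1 : Normc.normc (u x - w) <= e x by near: x.
apply: le_lt_trans h1 _.
have h2 : `|0 - e x| < d by near: x; exact: e0.
by rewrite sub0r normrN in h2; apply: le_lt_trans (ler_norm _) h2.
Unshelve. all: by end_near. Qed.

Definition expC_quot z : R[i] := if z == 0 then 1 else (expC z - 1) / z.

Lemma expC_quotE z : expC z = 1 + z * expC_quot z.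
Proof.
rewrite /expC_quot; case: eqVneq => [->|z0].
  by rewrite expC0 mul0r addr0.
by rewrite mulrCA divff// mulr1 addrC subrK.
Qed.

(** The complex derivative of the exponential at 0, assembled from the real Caratheodory slopes [p],
    [c], [s] of [expR], [cos], [sin] at 0. *)
Lemma cvg_expC_quot {T : Type} (F : set_system T) {FF : Filter F}
    (u : T -> plane R) : u @ F --> (0 : plane R) ->
  (expC_quot (u x) : plane R) @[x --> F] --> (1 : plane R).
Proof.
move=> u0.
have /is_derive1_caratheodory[p [pE cp p0]] := is_derive_expR (0 : R).
have /is_derive1_caratheodory[c [cE cc c0]] := is_derive_cos (0 : R).
have /is_derive1_caratheodory[s [sE cs s0]] := is_derive_sin (0 : R).
rewrite expR0 in p0 pE; rewrite cos0 in cE s0; rewrite sin0 oppr0 in c0.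
rewrite sin0 in sE.
pose x z : R := complex.Re z; pose y z : R := complex.Im z.
(* With [z = x + i y], [exp z - 1 - z] is [x (p cos y - 1) + y c + i y (expR x s - 1)], so its
   modulus is at most [|z| e z]. *)
pose e (z : R[i]) : R := `|p (x z) * cos (y z) - 1| + `|c (y z)|
  + `|expR (x z) * s (y z) - 1|.
have qe z : Normc.normc (expC_quot z - 1) <= e z.
  rewrite /expC_quot.
  case: eqVneq => [_|z0].
    by rewrite subrr Normc.normc0 /e !addr_ge0.
  have n0 : 0 < Normc.normc z.
    rewrite lt_neqAle normc_ge0 andbT eq_sym.
    by apply: contra_neq z0; exact: Normc.eq0_normc.
  have -> : (expC z - 1) / z - 1 = (expC z - 1 - z) / z by rewrite [RHS]mulrBl divff.
  rewrite Normc.normcM Normc.normcV ler_pdivrMr//.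
  have -> : expC z - 1 - z = (x z * (p (x z) * cos (y z) - 1))%:C +
      ((y z * c (y z))%:C + 'i * (y z * (expR (x z) * s (y z) - 1))%:C).
    have := pE (x z); have := cE (y z); have := sE (y z); rewrite !subr0 => se ce pe.
    rewrite /expC -/(x z) -/(y z).
    rewrite (_ : z = x z +i* y z); last by case: (z).
    apply/eqP; rewrite eq_complex /=; apply/andP; split; apply/eqP.
      have -> : expR (x z) = 1 + x z * p (x z) by rewrite mulrC -pe; ring.
      have -> : y z * c (y z) = cos (y z) - 1 by rewrite mulrC -ce.
      by ring.
    by rewrite se; ring.
  have nR (r : R) : Normc.normc r%:C = `|r|.
    by rewrite /= expr0n addr0 sqrtr_sqr.
  have ni (r : R) : Normc.normc ('i%C * r%:C) = `|r|.
    by rewrite Normc.normcM nR /= expr0n expr1n add0r sqrtr1 mul1r.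
  apply: (le_trans (le_normcD _ _)); rewrite nR.
  apply: (le_trans (lerD (lexx _) (le_normcD _ _))); rewrite nR ni !normrM.
  have hx : `|x z| <= Normc.normc z by exact: normRe_le.
  have hy : `|y z| <= Normc.normc z by exact: normIm_le.
  rewrite /e !mulrDl -addrA ![_ * Normc.normc z]mulrC.
  by rewrite lerD ?lerD// ler_wpM2r.
have ex : x (u v) @[v --> F] --> (0 : R) by exact: (cvg_Re u0).
have ey : y (u v) @[v --> F] --> (0 : R) by exact: (cvg_Im u0).
have e0 : e (u v) @[v --> F] --> (0 : R).
  have -> : (0 : R) = `|1 * 1 - 1 : R| + `|0 : R| + `|1 * 1 - 1 : R|.
    by rewrite mulr1 subrr normr0 !addr0.
  apply: cvgD; first apply: cvgD; apply: cvg_norm.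
  - apply: cvgB; last exact: cvg_cst.
    apply: cvgM; first by rewrite -p0; apply: continuous_cvg.
    rewrite -[X in _ --> X]cos0.
    by apply: (@continuous_cvg _ _ _ _ _ _ cos) => //; exact: continuous_cos.
  - by rewrite -c0; apply: continuous_cvg.
  - apply: cvgB; last exact: cvg_cst.
    apply: cvgM; last by rewrite -s0; apply: continuous_cvg.
    rewrite -[X in _ --> X]expR0.
    by apply: (@continuous_cvg _ _ _ _ _ _ expR) => //; exact: continuous_expR.
apply: (cvg_normc_squeeze _ e0).
by apply: nearW => v; exact: qe.
Qed.

Lemma f_t_exponent (K : numFieldType) (t z : K) : 1 - z != 0 ->
  t / 2 * ((1 + z) / (1 - z)) = t / (1 - z) - t / 2.
Proof. by move=> d0; field. Qed.

Lemma increment_factor (K : fieldType) (a b t q : K) :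
  1 - a != 0 -> 1 - b != 0 ->
  a * (1 + (t / (1 - a) - t / (1 - b)) * q) = b ->
  (a - b) * (1 + a * t / ((1 - a) * (1 - b)) * q) = 0.
Proof.
move=> a1 b1 e; rewrite [RHS](_ : 0 =
  a * (1 + (t / (1 - a) - t / (1 - b)) * q) - b); last by rewrite e subrr.
by field; rewrite a1 b1.
Qed.

Lemma f_tE (t : R) z : z != 1 ->
  f_t t z = z * expC (t%:C / (1 - z) - (t / 2)%:C).
Proof.
move=> z1; rewrite /f_t; congr (_ * expC _).
have d0 : 1 - z != 0 by rewrite subr_eq0 eq_sym.
have -> : (t / 2)%:C = t%:C / 2%:R :> R[i] by rewrite rmorphM fmorphV rmorph_nat.
exact: f_t_exponent.
Qed.

(** Equal images give [(a - b) G = 0] by [increment_factor], where [G] tends to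
    [1 + w t / (1 - w)^2], the derivative of [f_t] at [w] stripped of its exponential factor. Hence
    [G] is eventually nonzero. *)
Lemma f_t_locally_inj (t : R) {T : Type} (F : set_system T) {FF : Filter F}
    (a b : T -> plane R) (w : plane R) :
  w != 1 -> 1 + w * t%:C / ((1 - w) * (1 - w)) != 0 :> R[i] ->
  a @ F --> w -> b @ F --> w ->
  (\forall x \near F, f_t t (a x) = f_t t (b x)) ->
  \forall x \near F, a x = b x.
Proof.
move=> w1 G0 aw bw fab.
have d0 : (1 : plane R) - w != 0 by rewrite subr_eq0 eq_sym.
have cst1 : (fun=> 1 : plane R) @ F --> (1 : plane R) by exact: cvg_cst.
have cstt : (fun=> t%:C : plane R) @ F --> (t%:C : plane R) by exact: cvg_cst.
have da : (t%:C / (1 - a x) : plane R) @[x --> F] --> (t%:C / (1 - w) : plane R).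
  exact: cvgMC cstt (cvgVC d0 (cvgBC cst1 aw)).
have db : (t%:C / (1 - b x) : plane R) @[x --> F] --> (t%:C / (1 - w) : plane R).
  exact: cvgMC cstt (cvgVC d0 (cvgBC cst1 bw)).
pose q x := expC_quot (t%:C / (1 - a x) - t%:C / (1 - b x)).
have dq : (q x : plane R) @[x --> F] --> (1 : plane R).
  apply: cvg_expC_quot; rewrite -[X in _ --> X](subrr (t%:C / (1 - w) : plane R)).
  exact: (cvgBC da db).
have dG : (1 + a x * t%:C / ((1 - a x) * (1 - b x)) * q x : plane R)
    @[x --> F] --> (1 + w * t%:C / ((1 - w) * (1 - w)) * 1 : plane R).
  have d2 : (1 - w) * (1 - w) != 0 by exact: mulf_neq0.
  exact: (cvgDC cst1 (cvgMC (cvgMC (cvgMC aw cstt)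
    (cvgVC d2 (cvgMC (cvgBC cst1 aw) (cvgBC cst1 bw)))) dq)).
rewrite mulr1 in dG.
have na : \forall x \near F, 1 - a x != 0 := cvgr_neq0 _ (cvgBC cst1 aw) d0.
have nb : \forall x \near F, 1 - b x != 0 := cvgr_neq0 _ (cvgBC cst1 bw) d0.
have nG := cvgr_neq0 _ dG G0.
near=> x.
have ax1 : 1 - a x != 0 by near: x; exact: na.
have bx1 : 1 - b x != 0 by near: x; exact: nb.
have Gx : 1 + a x * t%:C / ((1 - a x) * (1 - b x)) * q x != 0.
  by near: x; exact: nG.
have fx : f_t t (a x) = f_t t (b x) by near: x.
have eab : a x * expC (t%:C / (1 - a x) - t%:C / (1 - b x)) = b x.
  apply: (mulIf (expC_neq0 (t%:C / (1 - b x) - (t / 2)%:C))).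
  rewrite -mulrA -expCD addrA subrK -!f_tE ?fx//.
    by rewrite eq_sym -subr_eq0.
  by rewrite eq_sym -subr_eq0.
rewrite expC_quotE in eab.
have /eqP := increment_factor ax1 bx1 eab.
by rewrite mulf_eq0 (negbTE Gx) orbF subr_eq0 => /eqP.
Unshelve. all: by end_near. Qed.

End LocalInjectivity.

Section Clamp.
Context {R : realType}.
Implicit Types r c : R.

(** Extends a path on [[0, c]] to a continuous path on the whole line, constant outside, so that the
    connectedness of the line applies to it. *)
Definition clamp c r : R := Num.max 0 (Num.min r c).

Lemma continuous_clamp c : continuous (clamp c).
Proof.
move=> r; apply: (@continuous_max _ _ (cst 0) (fun r => Num.min r c)).
  exact: cvg_cst.
by apply: (@continuous_min _ _ id (cst c)); [exact: cvg_id|exact: cvg_cst].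
Qed.

Lemma clamp_itv c r : 0 <= c -> 0 <= clamp c r <= c.
Proof.
by move=> c0; rewrite /clamp le_max lexx/= ge_max c0 ge_min lexx orbT.
Qed.

Lemma clamp_id c r : 0 <= r <= c -> clamp c r = r.
Proof. by case/andP => r0 rc; rewrite /clamp min_l// max_r. Qed.

End Clamp.

Section Chi.
Context {R : realType}.
Variables (t : R) (chi : plane R -> plane R).
Hypotheses (t_gt0 : 0 < t) (chiP : is_chi t chi).
Implicit Types z w : R[i].

Lemma cvg_chi {T : Type} (F : set_system T) {FF : Filter F}
    (u : T -> plane R) (z : plane R) :
  Normc.normc z <= 1 -> (\forall x \near F, Normc.normc (u x) <= 1) ->
  u @ F --> z -> (chi (u x) : plane R) @[x --> F] --> (chi z : plane R).
Proof.
move=> z1 u1 uz; have [_ /subspace_continuousP cchi _ _] := chiP.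
have := cchi z; rewrite /= normc_le1 => /(_ z1); apply: cvg_trans.
move=> A /=; rewrite !nbhs_simpl /= => /uz; rewrite !nbhs_simpl /=.
move=> H; apply: filterS2 u1 H => x u1 /=; apply.
by rewrite normc_le1.
Qed.

Lemma f_t_chi z : Normc.normc z < 1 -> f_t t (chi z) = z.
Proof. by have [_ _ + _] := chiP; move=> + z1; apply; rewrite normc_lt1. Qed.

Lemma normc_real (r : R) : 0 <= r -> Normc.normc r%:C = r.
Proof. by move=> r0; rewrite /= expr0n addr0 sqrtr_sqr ger0_norm. Qed.

Lemma cvg_real {T : Type} (F : set_system T) {FF : Filter F} (u : T -> R) (a : R) :
  u @ F --> a -> ((u x)%:C : plane R) @[x --> F] --> (a%:C : plane R).
Proof. by move=> ua; apply/cvg_complexP; split => //=; exact: cvg_cst. Qed.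

Lemma cvg_chi_ray z (r : R) : Normc.normc z <= 1 ->
  (chi ((clamp 1 x)%:C * z) : plane R) @[x --> r] -->
  (chi ((clamp 1 r)%:C * z) : plane R).
Proof.
move=> z1.
have b (x : R) : Normc.normc ((clamp 1 x)%:C * z) <= 1.
  have /andP[c0 c1] := clamp_itv x (@ler01 R).
  by rewrite Normc.normcM normc_real// mulr_ile1// normc_ge0.
apply: cvg_chi; [exact: b|exact: nearW|].
by apply: cvgMC; [apply: cvg_real; exact: continuous_clamp|exact: cvg_cst].
Qed.

(* On the unit circle [f_t] has modulus 1, while [f_t (chi (r z)) = r z]: the
   image of a ray under [chi] cannot cross the circle. *)
Lemma normc_chi_le1 z : Normc.normc z <= 1 -> Normc.normc (chi z) <= 1.
Proof.
move=> z1; rewrite leNgt; apply/negP => cz.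
have [_ _ _ chi0] := chiP.
pose n (r : R) := Normc.normc (chi ((clamp 1 r)%:C * z)).
have cn : continuous n by move=> r; apply: cvg_normc; exact: cvg_chi_ray.
have n0 : n 0 = 0.
  by rewrite /n clamp_id ?lexx ?ler01// mul0r chi0 Normc.normc0.
have n1 : n 1 = Normc.normc (chi z).
  by rewrite /n clamp_id ?lexx ?ler01// mul1r.
have [|r] := @IVT _ n 0 1 1 ler01 (continuous_subspaceT cn).
  by rewrite n0 n1 ge_min ler01/= le_max (ltW cz) orbT.
rewrite in_itv/= => /andP[r0 r1] nr1.
move: r1; rewrite le_eqVlt => /predU1P[r1|r1].
  by move: cz; rewrite -n1 -{1}nr1 r1 ltxx.
have rz1 : Normc.normc (r%:C * z) < 1.
  rewrite Normc.normcM normc_real//.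
  by apply: le_lt_trans r1; rewrite ler_piMr.
have := normc_f_t_unit t nr1; rewrite clamp_id ?r0 ?ltW// f_t_chi// => e.
by move: rz1; rewrite e ltxx.
Qed.

(** Radial limit of [f_t (chi (r z)) = r z] as [r] increases to 1; [f_t] is continuous at [chi z]
    because this is not 1. *)
Lemma f_t_chi_closed z : Normc.normc z <= 1 -> chi z != 1 -> f_t t (chi z) = z.
Proof.
move=> z1 cz.
have c1 : clamp 1 1 = 1 :> R by rewrite clamp_id// lexx ler01.
have h1 : (f_t t (chi ((clamp 1 x)%:C * z)) : plane R) @[x --> (1 : R)^'-] -->
    (f_t t (chi z) : plane R).
  apply: cvg_f_t => //; apply: cvg_at_left_filter.
  by have := @cvg_chi_ray z 1 z1; rewrite c1 mul1r.
have h2 : (f_t t (chi ((clamp 1 x)%:C * z)) : plane R) @[x --> (1 : R)^'-] -->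
    (z : plane R).
  have : ((clamp 1 x)%:C * z : plane R) @[x --> (1 : R)^'-] --> (z : plane R).
    have : ((clamp 1 x)%:C * z : plane R) @[x --> (1 : R)] -->
        ((clamp 1 1)%:C * z : plane R).
      by apply: cvgMC; [apply: cvg_real; exact: continuous_clamp|exact: cvg_cst].
    by rewrite c1 mul1r; exact: cvg_at_left_filter.
  apply: cvg_trans; apply: near_eq_cvg; near=> x.
  have x1 : x < 1 by [].
  have x0 : 0 <= x by near: x; exact: nbhs_left_ge.
  rewrite clamp_id ?x0 ?ltW// f_t_chi// Normc.normcM normc_real//.
  by apply: le_lt_trans x1; rewrite ler_piMr.
exact: cvg_unique h1 h2.
Unshelve. all: by end_near. Qed.

(* The critical points of [f_t] off the unit circle are real and negative, hence
   not in [|f_t| < 1]. *)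
Lemma f_t_noncritical w : Normc.normc w < 1 -> Normc.normc (f_t t w) < 1 ->
  1 + w * t%:C / ((1 - w) * (1 - w)) != 0.
Proof.
move=> w1 fw1; have [->|w0] := eqVneq w 0.
  by rewrite !mul0r addr0 oner_neq0.
have wn1 : w != 1.
  by apply: contraTneq w1 => ->; rewrite Normc.normc1 ltxx.
have d0 : 1 - w != 0 by rewrite subr_eq0 eq_sym.
apply/negP => /eqP e.
have {e} : (1 - w) * (1 - w) + w * t%:C = 0.
  have d2 : (1 - w) * (1 - w) != 0 by exact: mulf_neq0.
  apply: (mulIf (invr_neq0 d2)).
  by rewrite mul0r mulrDl mulfV.
have na : `|complex.Re w| < 1 by exact: le_lt_trans (normRe_le w) w1.
have nw : complex.Re w ^+ 2 + complex.Im w ^+ 2 < 1.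
  by rewrite -normc_sqr expr_lt1// normc_ge0.
case: w w0 wn1 d0 w1 fw1 na nw => a b w0 wn1 d0 w1 fw1 /= na nw /eqP.
rewrite eq_complex/= => /andP[/eqP eR /eqP eI].
(* The imaginary part of [(1 - w)^2 + t w = 0]. If [b != 0] then [t = 2 - 2 a], and the real part
   becomes [1 - a^2 - b^2 = 0]: a root on the unit circle. *)
have bt : b * (t - 2 + 2 * a) = 0 by rewrite -[RHS]eI; ring.
have [b0|b0] := eqVneq b 0; last first.
  move/eqP: bt; rewrite mulf_eq0 (negbTE b0)/= => /eqP bt.
  have tE : t = 2 - 2 * a by lra.
  move: eR; rewrite tE => eR; have : 1 - a ^+ 2 - b ^+ 2 = 0 by rewrite -[RHS]eR; ring.
  lra.
subst b; have {eR} eR : (1 - a) ^+ 2 + a * t = 0 by rewrite -[RHS]eR; ring.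
have a0 : a < 0.
  rewrite ltNge; apply/negP => a0.
  have : 0 <= a * t by rewrite mulr_ge0// ltW.
  have : 0 < (1 - a) ^+ 2.
    rewrite exprn_even_gt0//= subr_eq0 eq_sym; apply: contra_neq wn1 => ->.
    by [].
  lra.
have na0 : 0 < - a by lra.
pose s := ln (- a).
have sE : expR s = - a by rewrite lnK.
have wE : a +i* 0 = expC (s +i* pi) :> R[i].
  by rewrite expC_polar sE /cis cospi sinpi; simpc.
have a1 : - a < 1 by move: na; rewrite ltr_norml => /andP[]; lra.
have s0 : s < 0 by rewrite -ltr_expR sE expR0.
have D0 : cosh s - cos pi != 0 :> R by rewrite gt_eqF// coshBcos_gt0// lt_eqF.
have D1 : 0 < cosh s - cos pi by rewrite coshBcos_gt0// lt_eqF.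
move: fw1; rewrite wE normc_f_t// -expR0 ltr_expR mulrAC.
rewrite pmulr_llt0 ?invr_gt0// nmulr_rlt0// cospi opprK => h.
(* At the real root [- exp s] this gives [profile s + 1 = (cosh s + 1) (1 - sinhc s) < 0], while
   [|f_t| < 1] with [s < 0] requires [profile s + 1 > 0]. *)
have tE : t / 2 = cosh s + 1.
  have e1 : expR s * expR (- s) = 1 by rewrite -expRD subrr expR0.
  have : expR s * (t / 2) = expR s * (cosh s + 1).
    rewrite /cosh; have -> : expR s * ((expR s + expR (- s)) / 2 + 1) =
      (expR s ^+ 2 + expR s * expR (- s)) / 2 + expR s by ring.
    by rewrite e1 sE; lra.
  by apply: mulfI; rewrite gt_eqF// expR_gt0.
have : 1 < sinhc s.
  rewrite -sinhcN /sinhc oppr_eq0 (lt_eqF s0) ltr_pdivlMr ?oppr_gt0// mul1r.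
  by rewrite sinh_gt_id// oppr_gt0.
move: h; rewrite /profile tE; have := cosh_gt0 s; nra.
Qed.

(* The set [Z] of radii at which [chi (f_t z) = z] contains 0 and is open and
   closed. *)
Lemma chi_phase (x : R) : open_angles t x ->
  chi (cis (phase t x)) = expC (- log_r t x +i* x).
Proof.
move=> Ax; have [S0 hS rE] := log_rP t_gt0 Ax.
set S := log_r t x in S0 hS *.
have [_ _ _ chi0] := chiP.
pose rho := expR (- S); have rho0 : 0 < rho by exact: expR_gt0.
have rho1 : rho < 1 by rewrite /rho -expR0 ltr_expR; lra.
pose g (r : R) : plane R := (clamp rho r)%:C * cis x.
have cl (r : R) := clamp_itv r (ltW rho0).
have ng (r : R) : Normc.normc (g r) = clamp rho r.
  by rewrite Normc.normcM normc_cis mulr1 normc_real//; case/andP: (cl r).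
have g1 r : g r != 1.
  apply/eqP => e; have := ng r; rewrite e Normc.normc1 => e1.
  by case/andP: (cl r) => _; rewrite -e1 leNgt rho1.
have cg (r : R) : g r' @[r' --> r] --> g r.
  by apply: cvgMC; [apply: cvg_real; exact: continuous_clamp|exact: cvg_cst].
have fg_lt (r : R) : clamp rho r < rho -> Normc.normc (f_t t (g r)) < 1.
  move=> cr; have /andP[c0 _] := cl r; move: c0; rewrite le_eqVlt => /predU1P[c0|c0].
    by rewrite /g -c0 mul0r f_t0 Normc.normc0 ltr01.
  rewrite /g -(lnK c0) -expC_polar f_t_inner_lt1//.
  by rewrite -/S -ltr_expR lnK.
have g_rho (r : R) : clamp rho r = rho -> g r = expC (- S +i* x).
  by move=> e; rewrite /g e /rho expC_polar.
have fg_le (r : R) : Normc.normc (f_t t (g r)) <= 1.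
  have /andP[_] := cl r; rewrite le_eqVlt => /predU1P[e|/fg_lt/ltW//].
  by rewrite g_rho// f_t_phase_inner// normc_cis.
pose d (r : R) : plane R := chi (f_t t (g r)).
have cd (r : R) : d r' @[r' --> r] --> d r.
  have c1 : (f_t t (g r') : plane R) @[r' --> r] --> (f_t t (g r) : plane R).
    exact: cvg_f_t (g1 r) (cg r).
  by apply: (cvg_chi (fg_le r) _ c1); apply: nearW => r'; exact: fg_le.
pose Z := [set r : R | d r = g r].
have Z0 : Z 0.
  by rewrite /Z/= /d /g clamp_id ?lexx ?ltW// mul0r f_t0 chi0.
have Zcl : closed Z.
  have -> : Z = (fun r => Normc.normc (d r - g r)) @^-1` [set 0].
    apply/seteqP; split => r /=.
      by rewrite /Z/= => ->; rewrite subrr Normc.normc0.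
    by move=> /Normc.eq0_normc/eqP; rewrite subr_eq0 => /eqP.
  apply: closed_comp => // r _; apply: cvg_normc.
  by apply: cvgBC; [exact: cd|exact: cg].
suff : Z rho.
  rewrite /Z /= /d /g clamp_id ?lexx ?ltW// -expC_polar.
  by rewrite f_t_phase_inner.
(* Local injectivity is available only where [|f_t| < 1], that is below the radius [rho]. Assuming
   that [rho] is not in [Z] confines [Z] to such radii; then [Z] is clopen, hence the whole line,
   and contains [rho] after all. *)
apply: contrapT => nZ.
have Zlt (r : R) : Z r -> clamp rho r < rho.
  move=> Zr; rewrite ltNge; apply/negP => rr; apply: nZ.
  have e : clamp rho r = rho by apply/le_anti; rewrite rr; case/andP: (cl r) => _ ->.
  have e' : clamp rho rho = rho by rewrite clamp_id// lexx ltW.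
  by move: Zr; rewrite /Z /= /d !g_rho.
have Zop : open Z.
  rewrite openE => r Zr; have cr := Zlt r Zr; have fr := fg_lt r cr.
  have nr1 : Normc.normc (g r) < 1 by rewrite ng (lt_trans cr).
  have dg : d r = g r := Zr.
  have dr : d r' @[r' --> r] --> g r by rewrite -dg; exact: cd.
  have lt_near : \forall r' \near r, clamp rho r' < rho.
    exact: (cvgr_lt _ (@continuous_clamp _ rho r) _ cr).
  have : \forall r' \near r, d r' = g r'.
    apply: (f_t_locally_inj (g1 r) (f_t_noncritical nr1 fr) dr (cg r)).
    by apply: filterS lt_near => r' cr'; rewrite /d f_t_chi// fg_lt.
  by [].
have : connected [set: R] by apply/connected_intervalP => ? ? ? ? ? ?.
move=> /(_ Z) ZT; apply: nZ; suff -> : Z = setT by [].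
apply: ZT; [by exists 0|by exists Z => //; rewrite setTI|].
by exists Z => //; rewrite setTI.
Qed.

(** The Poisson quotient at [exp (- S + i x)] is [sinh S / (cosh S - cos x)], which the boundary
    equation turns into [2 S / t]. *)
Lemma kappa_phase (x : R) : open_angles t x ->
  kappa chi (cis (phase t x)) = log_r t x / (pi * t).
Proof.
move=> Ax; have [S0 hS rE] := log_rP t_gt0 Ax.
rewrite /kappa chi_phase//; set S := log_r t x in S0 hS *.
have e1 : expR S * expR (- S) = 1 by rewrite -expRD subrr expR0.
have D0 : cosh S - cos x != 0 by rewrite gt_eqF// coshBcos_gt0// gt_eqF.
have DE := coshBcosE t_gt0 Ax; rewrite -/S in DE.
have E0 := lt0r_neq0 (expR_gt0 (- S)); have sh0 := lt0r_neq0 (sinh_gt0 S0).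
have S00 := lt0r_neq0 S0; have t0 := lt0r_neq0 t_gt0.
have n1 : 1 - Normc.normc (expC (- S +i* x)) ^+ 2 = 2 * expR (- S) * sinh S.
  by rewrite normc_expC/= /sinh; field: e1.
have n2 : Normc.normc (1 - expC (- S +i* x)) ^+ 2 =
    2 * expR (- S) * (cosh S - cos x).
  have := sin2cos2 x => sc.
  by rewrite normc_sqr /= /cosh; field: e1 sc.
rewrite n1 n2 DE; have p0 := lt0r_neq0 (@pi_gt0 R).
move: (pi : R) p0 => p p0.
by field; rewrite p0 t0 S00 sh0 E0.
Qed.

Lemma kappa_ge0 z : Normc.normc z <= 1 -> 0 <= kappa chi z.
Proof.
move=> z1; have c1 := normc_chi_le1 z1.
rewrite /kappa mulr_ge0//; first by rewrite divr_ge0// mulr_ge0// pi_ge0.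
by rewrite divr_ge0 ?sqr_ge0// subr_ge0 expr_le1// normc_ge0.
Qed.

(** A nonzero density forces [|chi| < 1], so [chi (cis p)] is a point of the open disk where
    [|f_t| = 1]: it lies on the inner boundary curve. *)
Lemma kappa_neq0_phase (p : R) : kappa chi (cis p) != 0 ->
  exists2 x, angles t x & cis p = cis (phase t x).
Proof.
move=> kp; set w : R[i] := chi (cis p).
have cp1 : Normc.normc (cis p) <= 1 by rewrite normc_cis.
have w1 : Normc.normc w < 1.
  rewrite lt_neqAle normc_chi_le1// andbT; apply: contra_neq kp => w1.
  by rewrite /kappa -/w w1 expr1n subrr mul0r mulr0.
have wn1 : w != 1 by apply: contraTneq w1 => ->; rewrite Normc.normc1 ltxx.
have fw : f_t t w = cis p by exact: f_t_chi_closed.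
have w0 : w != 0.
  apply: contra_eq_neq fw => ->; rewrite f_t0 eq_sym; apply: contra_eq_neq (normc_cis p) => ->.
  by rewrite Normc.normc0 eq_sym oner_neq0.
have [x xpi] := polar w0; set s := ln _ => wE.
have s0 : s < 0 by rewrite /s -ltr_expR expR0 lnK// posrE lt_neqAle normc_ge0 andbT eq_sym;
  apply: contra_neq w0; exact: Normc.eq0_normc.
have D0 : cosh s - cos x != 0 by rewrite gt_eqF// coshBcos_gt0// lt_eqF.
have h : profile t s = cos x.
  have := congr1 (@Normc.normc R) fw; rewrite normc_cis wE normc_f_t// -expR0.
  move=> /expR_inj/eqP; rewrite !mulf_eq0 (lt_eqF s0) invr_eq0 (negbTE D0)/=.
  by rewrite subr_eq0 => /eqP.
have Ax : open_angles t x.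
  apply: (@profile_lt_lt _ t 0 `|s|) => //; first by rewrite normr_gt0 lt_eqF.
    exact: cos_geN1.
  by rewrite profile_norm h.
have [S0 hS _] := log_rP t_gt0 Ax.
have sS : s = - log_r t x.
  have := @profile_ltE _ t _ _ s S0 (cos_geN1 x) hS.
  have ns0 : 0 < - s by lra.
  have := @profile_ltE _ t (- s) (cos x) (log_r t x) ns0 (cos_geN1 x); rewrite profileN h => /(_ erefl).
  rewrite hS ltxx (ltr0_norm s0) (gtr0_norm S0) => /esym/negbT + /esym/negbT.
  by rewrite -!leNgt => ? ?; lra.
exists x; first by rewrite anglesE.
by rewrite -fw wE sS f_t_phase_inner.
Qed.

End Chi.

(** * Change of variables *)

Section ImageDensity.
Context {R : realType}.
Variables (D : set R) (F g : R -> R).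
Local Open Scope ereal_scope.

(* The unused proof arguments let the measure structure be inferred. *)
Definition image_density (mD : measurable D) (mF : measurable_fun D F)
    (mg : measurable_fun D g) (g0 : forall x, D x -> (0 <= g x)%R)
    (B : set R) : \bar R :=
  \int[lebesgue_measure]_(x in D `&` F @^-1` B) (g x)%:E.

Variables (mD : measurable D) (mF : measurable_fun D F)
  (mg : measurable_fun D g) (g0 : forall x, D x -> (0 <= g x)%R).

Let image_density0 : image_density mD mF mg g0 set0 = 0.
Proof. by rewrite /image_density preimage_set0 setI0 integral_set0. Qed.

Let image_density_ge0 B : 0 <= image_density mD mF mg g0 B.
Proof. by apply: integral_ge0 => x [Dx _]; rewrite lee_fin g0. Qed.

Let image_density_sigma_additive :
  semi_sigma_additive (image_density mD mF mg g0).
Proof.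
move=> B mB tB mUB; apply: cvg_toP.
  apply: ereal_nondecreasing_is_cvgn => m n mn.
  by apply: lee_sum_nneg_natr => // k _ _; exact: image_density_ge0.
rewrite /image_density preimage_bigcup setI_bigcupr ge0_integral_bigcup//=.
- by move=> k; exact: mF.
- rewrite -setI_bigcupr -preimage_bigcup; apply/measurable_EFinP.
  by apply: measurable_funS mg => //; exact: subIsetl.
- by move=> x [k _ [Dx _]]; rewrite lee_fin g0.
- move=> i j _ _ [x [[_ Bi] [_ Bj]]]; apply: tB => //.
  by exists (F x).
Qed.

HB.instance Definition _ := isMeasure.Build _ _ _ (image_density mD mF mg g0)
  image_density0 image_density_ge0 image_density_sigma_additive.

End ImageDensity.

Lemma exists_natN_lt {R : realType} (x : R) : exists n : nat, - n%:R < x.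
Proof.
exists (Num.truncn `|x|).+1; rewrite ltrNl.
by apply: le_lt_trans (truncnS_gt `|x|); rewrite -normrN ler_norm.
Qed.

(** * Substitution along an increasing map of an open interval *)

Section ChangeOfVariables.
Context {R : realType}.
Variables (F dF G : R -> R) (c d : R).
Hypotheses (dFE : forall x, x \in `]c, d[ -> is_derive x 1 F (dF x))
  (dF_continuous : forall x, x \in `]c, d[ -> {for x, continuous dF})
  (dF_gt0 : forall x, x \in `]c, d[ -> 0 < dF x)
  (G_continuous : forall x, x \in `]c, d[ -> {for F x, continuous G})
  (G_ge0 : forall x, x \in `]c, d[ -> 0 <= G (F x)).
Implicit Types x a b : R.

Local Notation mu := (@lebesgue_measure R).

Lemma continuous_of_dF x : x \in `]c, d[ -> {for x, continuous F}.
Proof.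
move=> /dFE D; apply/differentiable_continuous/derivable1_diffP.
by case: D.
Qed.

Lemma increasing_of_dF : {in `]c, d[ &, {homo F : x y / x < y}}.
Proof.
apply: gtr0_derive1_lt_oo => x xJ.
- by case: (dFE xJ).
- by rewrite derive1E; have [_ ->] := dFE xJ; exact: dF_gt0.
- by move: xJ; rewrite inE; exact: continuous_of_dF.
Qed.

Lemma nondecreasing_of_dF : {in `]c, d[ &, {mono F : x y / x <= y}}.
Proof. exact: le_mono_in increasing_of_dF. Qed.

Lemma increasing_mono_of_dF : {in `]c, d[ &, {mono F : x y / x < y}}.
Proof. exact: leW_mono_in nondecreasing_of_dF. Qed.

Lemma subitv_of x a b : c < a -> b < d -> x \in `[a, b] -> x \in `]c, d[.
Proof.
move=> ca bd; rewrite !in_itv/= => /andP[ax xb].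
by rewrite (lt_le_trans ca)// (le_lt_trans xb).
Qed.

Lemma image_itv_of_dF a b : c < a -> a <= b -> b < d ->
  F @` `[a, b] = `[F a, F b]%classic.
Proof.
move=> ca ab bd; have sub x := @subitv_of x a b ca bd.
have aI : a \in `[a, b] by rewrite in_itv/= lexx.
have bI : b \in `[a, b] by rewrite in_itv/= lexx andbT.
apply/seteqP; split => y.
  move=> [x /= xab <-]; rewrite in_itv/= !nondecreasing_of_dF ?sub//.
move=> /=; rewrite in_itv/= => yab; have [||x xab xy] := @IVT _ F a b y ab.
- apply: continuous_in_subspaceT => x; rewrite inE/= => /sub xJ.
  exact: continuous_of_dF.
- case/andP: yab => y1 y2.
  by rewrite ge_min y1/= le_max y2 orbT.
by exists x.
Qed.

Lemma within_continuous_G a b : c < a -> a <= b -> b < d ->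
  {within `[F a, F b], continuous G}.
Proof.
move=> ca ab bd; apply: continuous_in_subspaceT => y; rewrite inE.
rewrite -(image_itv_of_dF ca ab bd) => -[x /= /(subitv_of ca bd) xJ <-].
exact: G_continuous.
Qed.

Lemma change_of_variables_itv a b : c < a -> a <= b -> b < d ->
  (\int[mu]_(y in `[F a, F b]) (G y)%:E =
   \int[mu]_(x in `[a, b]) (G (F x) * dF x)%:E)%E.
Proof.
move=> ca ab bd; have sub x := @subitv_of x a b ca bd.
have aI : a \in `]c, d[ by apply: sub; rewrite in_itv/= lexx.
have bI : b \in `]c, d[ by apply: sub; rewrite in_itv/= lexx andbT.
have F'E x : x \in `]c, d[ -> derive1 F x = dF x.
  by move=> /dFE[_ e]; rewrite derive1E.
have F'n x : x \in `]c, d[ -> \near x, dF x = derive1 F x.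
  move=> xJ; near=> y; rewrite F'E//.
  by near: y; apply: near_in_itvoo.
have F'c x : x \in `]c, d[ -> derive1 F y @[y --> x] --> derive1 F x.
  move=> xJ; rewrite F'E//; apply: cvg_trans (dF_continuous xJ).
  exact: near_eq_cvg (F'n x xJ).
rewrite integration_by_substitution_increasing//.
- apply: eq_integral => x; rewrite inE/= => /sub xJ.
  by rewrite -(F'E _ xJ).
- by move=> x y /sub xJ /sub yJ; exact: increasing_of_dF.
- move=> x xab; apply: F'c; apply: sub.
  by move: xab; rewrite !in_itv/= => /andP[/ltW -> /ltW ->].
- by apply/cvg_ex; exists (derive1 F a); apply: cvg_at_right_filter; exact: F'c.
- by apply/cvg_ex; exists (derive1 F b); apply: cvg_at_left_filter; exact: F'c.
- split.
  + move=> x xab; have /dFE[] // : x \in `]c, d[.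
    by apply: sub; move: xab; rewrite !in_itv/= => /andP[/ltW -> /ltW ->].
  + by apply: cvg_at_right_filter; exact: continuous_of_dF.
  + by apply: cvg_at_left_filter; exact: continuous_of_dF.
- exact: within_continuous_G.
Unshelve. all: by end_near. Qed.

Let density x : R := G (F x) * dF x.

Lemma density_continuous x : x \in `]c, d[ -> {for x, continuous density}.
Proof.
move=> xJ; apply: cvgM; last exact: dF_continuous.
apply: (@continuous_cvg _ _ _ _ _ _ G); first exact: G_continuous.
exact: continuous_of_dF.
Qed.

Lemma density_ge0 x : x \in `]c, d[ -> 0 <= density x.
Proof. by move=> xJ; rewrite mulr_ge0 ?G_ge0// ltW// dF_gt0. Qed.

Lemma density_measurable : measurable_fun `]c, d[ density.
Proof.
apply: open_continuous_measurable_fun; first exact: interval_open.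
by move=> x; rewrite inE; exact: density_continuous.
Qed.

Lemma measurable_of_dF : measurable_fun `]c, d[ F.
Proof.
apply: open_continuous_measurable_fun; first exact: interval_open.
by move=> x; rewrite inE; exact: continuous_of_dF.
Qed.

(* Both sides are finite measures in [B], so they agree once they agree on the
   half-lines [`]x, +oo[]. *)
Lemma change_of_variables_compact a b (B : set R) :
  c < a -> a <= b -> b < d -> measurable B ->
  (\int[mu]_(x in `[a, b] `&` F @^-1` B) (density x)%:E =
   \int[mu]_(y in `[F a, F b] `&` B) (G y)%:E)%E.
Proof.
move=> ca ab bd; have sub x := @subitv_of x a b ca bd.
have aI : a \in `[a, b] by rewrite in_itv/= lexx.
have bI : b \in `[a, b] by rewrite in_itv/= lexx andbT.
have sub' : `[a, b]%classic `<=` `]c, d[%classic by move=> x /=; exact: sub.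
have mF : measurable_fun `[a, b] F by apply: measurable_funS measurable_of_dF.
have mg : measurable_fun `[a, b] density by apply: measurable_funS density_measurable.
have g0 x : `[a, b]%classic x -> 0 <= density x.
  by move=> /= /sub xJ; exact: density_ge0.
have mG : measurable_fun `[F a, F b] G.
  by apply: subspace_continuous_measurable_fun => //; exact: within_continuous_G.
have G0 y : `[F a, F b]%classic y -> 0 <= G y.
  by rewrite -(image_itv_of_dF ca ab bd) => -[x /= /sub xJ <-]; exact: G_ge0.
have mab : measurable (`[a, b]%classic : set R) by [].
have mFab : measurable (`[F a, F b]%classic : set R) by [].
have mid : measurable_fun `[F a, F b] (@id R) by exact: measurable_id.
pose g (n : nat) : set R := `](- n%:R), +oo[%classic.
have H1 : @measurable _ R = <<s @RGenOInfty.G R >>.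
  exact (RGenOInfty.measurableE R).
have H2 : setI_closed (@RGenOInfty.G R).
  move=> _ _ [x ->] [y ->]; exists (Num.max x y).
  by apply/seteqP; split => z /=; rewrite !in_itv/= !andbT gt_max => /andP.
have H3 n : RGenOInfty.G (g n) by exists (- n%:R).
have H4 : \bigcup_k g k = setT.
  rewrite -subTset => x _; have [n xn] := exists_natN_lt (x : R).
  by exists n => //; rewrite /g /= in_itv/= andbT.
have H5 A : RGenOInfty.G A ->
    image_density mab mF mg g0 A = image_density mFab mid mG G0 A.
  move=> [x ->]; rewrite /image_density.
  have [xa|ax] := ltP x (F a).
    rewrite (_ : _ `&` _ = `[a, b]%classic); last first.
      apply/seteqP; split => y /=; first by case.
      move=> yab; split => //; rewrite in_itv/= andbT (lt_le_trans xa)//.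
      rewrite nondecreasing_of_dF ?sub//.
      by move: yab; rewrite in_itv/= => /andP[].
    rewrite (_ : _ `&` _ = `[F a, F b]%classic); last first.
      apply/seteqP; split => y /=; first by case.
      move=> yab; split => //; move: yab; rewrite !in_itv/= andbT.
      by case/andP => ay _; exact: lt_le_trans ay.
    by rewrite change_of_variables_itv.
  have [bx|xb] := leP (F b) x.
    rewrite (_ : _ `&` _ = set0); last first.
      rewrite -subset0 => y /= [yab]; rewrite in_itv/= andbT ltNge.
      rewrite (le_trans _ bx)// nondecreasing_of_dF ?sub//.
      by move: yab; rewrite in_itv/= => /andP[].
    rewrite (_ : _ `&` _ = set0) ?integral_set0//.
    rewrite -subset0 => y /= []; rewrite !in_itv/= andbT => /andP[_ yb].
    by rewrite ltNge (le_trans yb bx).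
  have [e /= eab eE] : (F @` `[a, b]) x.
    by rewrite image_itv_of_dF//= in_itv/= ax ltW.
  have eJ := sub _ eab; move: (eab); rewrite in_itv/= => /andP[ae eb].
  have sube y : y \in `]e, b] -> y \in `]c, d[.
    move=> yeb; apply: sub; move: yeb; rewrite !in_itv/= => /andP[ey ->].
    by rewrite (le_trans ae (ltW ey)).
  rewrite (_ : _ `&` _ = `]e, b]%classic); last first.
    apply/seteqP; split => y /=; rewrite !in_itv/= !andbT.
      move=> [/andP[ay yb]]; rewrite -eE increasing_mono_of_dF ?sub//.
        by move=> ->.
      by rewrite in_itv/= ay.
    move=> /andP[ey yb]; rewrite yb (le_trans ae (ltW ey)); split => //.
    rewrite -eE increasing_mono_of_dF ?sub// in_itv/= yb andbT.
    exact: (le_trans ae (ltW ey)).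
  rewrite (_ : _ `&` _ = `]F e, F b]%classic); last first.
    apply/seteqP; split => y /=; rewrite !in_itv/= !andbT -eE.
      by move=> [/andP[_ ->] ->].
    move=> /andP[ey yb]; rewrite yb ey; split => //.
    by rewrite (le_trans _ (ltW ey))// nondecreasing_of_dF// sub.
  rewrite !integral_itv_obnd_cbnd; last 2 first.
  - apply/measurable_EFinP; apply: measurable_funS mG => // y /=.
    rewrite !in_itv/= => /andP[ey ->]; rewrite andbT (le_trans _ (ltW ey))//.
    by rewrite nondecreasing_of_dF// sub.
  - apply/measurable_EFinP; apply: measurable_funS mg => // y /=.
    by rewrite !in_itv/= => /andP[ey ->]; rewrite (le_trans ae (ltW ey)).
  by rewrite change_of_variables_itv// (lt_le_trans ca).
have H6 n : (image_density mab mF mg g0 (g n) < +oo)%E.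
  apply: (@le_lt_trans _ _ (\int[mu]_(x in `[a, b]) (density x)%:E)%E).
    apply: ge0_subset_integral => //.
    - exact: (mF mab _ (measurable_itv _)).
    - exact/measurable_EFinP.
  have /integrable_fin_num : mu.-integrable `[a, b] (EFin \o density).
    apply: continuous_compact_integrable; first exact: segment_compact.
    apply: continuous_in_subspaceT => x; rewrite inE/= => /sub.
    exact: density_continuous.
  move=> /(_ mab); rewrite ge0_fin_numE//.
  by apply: integral_ge0 => x xab; rewrite lee_fin; exact: (g0 x xab).
move=> mB.
exact: (@measure_unique _ R R (@RGenOInfty.G R) g H1 H2 H3 H4
  (image_density mab mF mg g0) (image_density mFab mid mG G0) H5 H6 B mB).
Qed.

(** The hypotheses hold only inside []c, d[], so compact subintervals exhaust it and monotone
    convergence applies on both sides. *)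
Lemma change_of_variables (B : set R) : c < d -> measurable B ->
  (\int[mu]_(x in `]c, d[ `&` F @^-1` B) (density x)%:E =
   \int[mu]_(y in (F @` `]c, d[) `&` B) (G y)%:E)%E.
Proof.
move=> cd mB.
(* The shift by 2 bounds [e n] by half the length, so that [a n <= b n] from [n = 0] on. *)
pose e (n : nat) := (d - c) / (n%:R + 2).
have e0 n : 0 < e n by rewrite divr_gt0 ?subr_gt0// ltr_wpDl.
have e1 n : e n <= (d - c) / 2.
  by rewrite ler_pM2l ?subr_gt0// lef_pV2 ?posrE ?lerDr// ltr_wpDl.
have e_nincr m n : (m <= n)%N -> e n <= e m.
  move=> mn; rewrite ler_pM2l ?subr_gt0// lef_pV2 ?posrE ?ltr_wpDl//.
  by rewrite lerD2r ler_nat.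
pose a n := c + e n; pose b n := d - e n.
have ca n : c < a n by rewrite ltrDl.
have bd n : b n < d by rewrite ltrBlDr ltrDl.
have ab n : a n <= b n by have := e1 n; rewrite /a /b; lra.
have sub n x : x \in `[a n, b n] -> x \in `]c, d[ by exact: subitv_of.
have aJ n : a n \in `]c, d[ by apply: (sub n); rewrite in_itv/= lexx ab.
have bJ n : b n \in `]c, d[ by apply: (sub n); rewrite in_itv/= lexx ab.
have JE : `]c, d[%classic = \bigcup_n `[a n, b n]%classic.
  apply/seteqP; split => x /=; last by move=> [n _]; exact: sub.
  rewrite in_itv/= => /andP[cx xd].
  pose k := Num.min (x - c) (d - x).
  have k0 : 0 < k by rewrite lt_min !subr_gt0 cx.
  pose n := Num.truncn ((d - c) / k); exists n => //.
  have en : e n <= k.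
    rewrite /e ler_pdivrMr ?ltr_wpDl// mulrC -ler_pdivrMr//.
    rewrite (le_trans (ltW (truncnS_gt _)))// -/n -natr1 lerD2l.
    by rewrite ler1n.
  have k1 : k <= x - c by rewrite ge_min lexx.
  have k2 : k <= d - x by rewrite ge_min lexx orbT.
  by rewrite /= in_itv/= /a /b; apply/andP; split; lra.
have nd1 : nondecreasing_seq (fun n => `[a n, b n]%classic `&` F @^-1` B).
  move=> m n mn; apply/subsetPset => x /= [xab Bx]; split => //.
  have := e_nincr _ _ mn; move: xab; rewrite !in_itv/= /a /b => /andP[? ?] ?.
  by apply/andP; split; lra.
have nd2 : nondecreasing_seq (fun n => `[F (a n), F (b n)]%classic `&` B).
  move=> m n mn; apply/subsetPset => y /= [yab By]; split => //.
  have := e_nincr _ _ mn => emn.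
  have amn : a n <= a m by rewrite /a lerD2l.
  have bmn : b m <= b n by rewrite /b lerD2l lerN2.
  move: yab; rewrite !in_itv/= => /andP[ay yb]; apply/andP; split.
    by apply: le_trans ay; rewrite nondecreasing_of_dF.
  by apply: (le_trans yb); rewrite nondecreasing_of_dF.
have mG n : measurable_fun `[F (a n), F (b n)] G.
  by apply: subspace_continuous_measurable_fun => //; exact: within_continuous_G.
have mFB n : measurable (`[a n, b n] `&` F @^-1` B).
  have : measurable_fun `[a n, b n] F.
    by apply: measurable_funS measurable_of_dF => // x /=; exact: sub.
  exact.
have c1 : (\int[mu]_(x in `[a n, b n] `&` F @^-1` B) (density x)%:E)%E
    @[n --> \oo] --> (\int[mu]_(x in `]c, d[ `&` F @^-1` B) (density x)%:E)%E.
  rewrite JE setI_bigcupl.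
  apply: (@ge0_nondecreasing_set_cvg_integral _ (measurableTypeR R) R _ (EFin \o density) _ nd1).
  - exact: mFB.
  - move=> n; apply/measurable_EFinP; apply: measurable_funS density_measurable => //.
    by move=> x /= [/sub].
  - by move=> n x /= [xab _]; rewrite lee_fin density_ge0// (sub n).
have c2 : (\int[mu]_(y in `[F (a n), F (b n)] `&` B) (G y)%:E)%E
    @[n --> \oo] --> (\int[mu]_(y in (F @` `]c, d[) `&` B) (G y)%:E)%E.
  have -> : F @` `]c, d[ `&` B = \bigcup_n (`[F (a n), F (b n)]%classic `&` B).
    rewrite JE image_bigcup setI_bigcupl; apply: eq_bigcupr => n _.
    by rewrite image_itv_of_dF.
  apply: (@ge0_nondecreasing_set_cvg_integral _ (measurableTypeR R) R _ (EFin \o G) _ nd2).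
  - by move=> n; exact: measurableI.
  - move=> n; apply/measurable_EFinP; apply: measurable_funS (mG n) => //.
  - move=> n y /= [yab _]; have : (F @` `[a n, b n]) y by rewrite image_itv_of_dF.
    by move=> [x /= /sub xJ <-]; rewrite lee_fin G_ge0.
apply: cvg_unique c1 _ => //.
apply: cvg_trans c2; apply: near_eq_cvg; near=> n.
by rewrite change_of_variables_compact.
Unshelve. all: by end_near. Qed.

End ChangeOfVariables.

(** * The law of the boundary angle *)

Lemma measurable_cis {R : realType} (B : set (borel_plane R)) :
  measurable B -> measurable ((@cis R) @^-1` B).
Proof.
suff : <<s @open (plane R) >> `<=` [set C | measurable ((@cis R) @^-1` C)] by exact.
apply: smallest_sub => [|C oC].
  split => [|C mC|F mF] /=.
  - by rewrite preimage_set0; exact: measurable0.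
  - by rewrite setTD preimage_setC; exact: measurableC.
  - by rewrite preimage_bigcup; exact: bigcupT_measurable.
by apply: open_measurable; move/continuousP: (@continuous_cis R); apply.
Qed.

Section Law.
Context {R : realType}.
Variables (t : R) (chi : plane R -> plane R).
Hypotheses (t_gt0 : 0 < t) (chiP : is_chi t chi).
Implicit Types (x p : R).

(** As [profile t 0 = 1 - t / 2], the first branch is [t > 4], where every ray meets [Sigma_t] and
    [acos] would be taken outside [[-1, 1]]. *)
Definition angle_max : R :=
  if profile t 0 < -1 then pi else acos (profile t 0).

Local Notation A := (open_angles t).
Local Notation J := (`](- angle_max), angle_max[).
Local Notation I := (`](- pi : R), pi]%classic).
Local Notation mu := (@lebesgue_measure R).

Lemma mem_angle_max x : (x \in J) = (`|x| < pi) && (profile t 0 < cos x).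
Proof.
have h1 : profile t 0 < 1 by rewrite profile0; have := t_gt0; lra.
have mE : (x \in J) = (`|x| < angle_max) by rewrite in_itv/= ltr_norml.
rewrite mE /angle_max; have [h|h] := ltP (profile t 0) (-1).
  by rewrite (lt_le_trans h (cos_geN1 x)) andbT.
have h11 : profile t 0 \in `[(-1), 1] by rewrite in_itv/= h ltW.
have h11' : -1 <= profile t 0 <= 1 by rewrite h ltW.
have cE : cos (acos (profile t 0)) = profile t 0 by rewrite acosK.
have aI : acos (profile t 0) \in `[0, pi] by rewrite in_itv/= acos_ge0// acos_lepi.
rewrite -{2}cE -(cos_norm x).
have [xpi|pix] := ltP `|x| pi.
  by rewrite ltr_cos// in_itv/= normr_ge0 ltW.
by apply/negbTE; rewrite -leNgt (le_trans _ pix)// acos_lepi.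
Qed.

Lemma mem_angle_max_open x : x \in J -> A x.
Proof. by rewrite mem_angle_max => /andP[]. Qed.

Lemma angle_max_gt0 : 0 < angle_max.
Proof.
have : (0 : R) \in J by rewrite mem_angle_max normr0 pi_gt0 cos0 profile0; have := t_gt0; lra.
by rewrite in_itv/= => /andP[].
Qed.

Lemma r_tN x : r_t t (- x) = r_t t x.
Proof. by rewrite /r_t !radiiE// cosN. Qed.

Lemma phaseN x : phase t (- x) = - phase t x.
Proof. by rewrite /phase /cauchy_im r_tN sinN cosN; ring. Qed.

Lemma phase_pi : phase t pi = pi.
Proof. by rewrite /phase /cauchy_im sinpi mulr0 mul0r mulr0 addr0. Qed.

Lemma phase0 : phase t 0 = 0.
Proof. by rewrite /phase /cauchy_im sin0 mulr0 mul0r mulr0 addr0. Qed.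

Let dphase_derive x : x \in J -> is_derive x 1 (phase t) (dphase t x).
Proof. by move=> /mem_angle_max_open Ax; exact: is_derive_phase. Qed.

Let dphase_continuous x : x \in J -> {for x, continuous (dphase t)}.
Proof. by move=> /mem_angle_max_open Ax; exact: continuous_dphase. Qed.

Let dphase_pos x : x \in J -> 0 < dphase t x.
Proof. by move=> /mem_angle_max_open Ax; exact: dphase_gt0. Qed.

(* [phase] being odd, if it reached [pi] at [x] then [cis (phase x)] would be
   equal to [cis (phase (- x))], whereas [chi] sends them to points with
   different arguments. *)
Lemma phase_range x : x \in J -> `|phase t x| < pi.
Proof.
wlog x0 : x / 0 <= x.
  move=> H xJ; have [x0|x0] := leP 0 x; first exact: H.
  rewrite -normrN -phaseN; apply: H; first by rewrite oppr_ge0 ltW.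
  by move: xJ; rewrite !in_itv/= ltrN2 andbC ltrNl.
move=> xJ; have mono := nondecreasing_of_dF dphase_derive dphase_pos.
have J0 : 0 \in J by rewrite in_itv/= oppr_lt0 angle_max_gt0.
have p0 : 0 <= phase t x by rewrite -phase0 mono.
rewrite ger0_norm// ltNge; apply/negP => pix.
have Jy y : 0 <= y <= x -> y \in J.
  move: xJ J0; rewrite !in_itv/= => /andP[_ x1] /andP[x2 _] /andP[y0 yx].
  by rewrite (lt_le_trans x2)// (le_lt_trans yx).
have [||y yI yE] := @IVT _ (phase t) 0 x pi x0.
- apply: continuous_in_subspaceT => y; rewrite inE/= in_itv/= => /Jy.
  exact: continuous_of_dF dphase_derive _.
- by rewrite phase0 ge_min pi_ge0/= le_max pix orbT.
rewrite in_itv/= in yI; have yJ := Jy _ yI; case/andP: (yI) => y0 _.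
have yNJ : - y \in J by move: yJ; rewrite !in_itv/= ltrN2 andbC ltrNl.
have Ay := mem_angle_max_open yJ; have ANy := mem_angle_max_open yNJ.
have := chi_phase t_gt0 chiP ANy; rewrite phaseN yE.
have -> : cis (- pi) = cis pi :> R[i] by rewrite /cis cosN sinN sinpi oppr0.
rewrite -yE (chi_phase t_gt0 chiP Ay) /log_r r_tN => /(congr1 (@complex.Im R))/=.
move=> /(mulfI (lt0r_neq0 (expR_gt0 _))); rewrite sinN => sy.
have sy0 : sin y = 0 by lra.
move: yJ; rewrite mem_angle_max => /andP[]; rewrite ger0_norm// => ypi _.
move: y0; rewrite le_eqVlt => /predU1P[y0|y0].
  by move: yE; rewrite -y0 phase0 => /esym/eqP; rewrite gt_eqF// pi_gt0.
by have := @sin_gt0_pi R y; rewrite y0 ypi sy0 ltxx => /(_ isT).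
Qed.

Local Notation K := (fun p => kappa chi (cis p)).

Lemma cvg_chi_cis p : (chi (cis q) : plane R) @[q --> p] --> (chi (cis p) : plane R).
Proof.
apply: (cvg_chi chiP); first by rewrite normc_cis.
  by apply: nearW => q; rewrite normc_cis.
exact: continuous_cis.
Qed.

Lemma continuous_kappa_cis p : chi (cis p) != 1 -> {for p, continuous K}.
Proof.
move=> c1; rewrite /continuous_at /kappa.
have cc := @cvg_chi_cis p.
have cn : Normc.normc (chi (cis q)) @[q --> p] --> Normc.normc (chi (cis p)).
  exact: cvg_normc cc.
have cst1 : (fun=> 1 : plane R) @ p --> (1 : plane R) by exact: cvg_cst.
have cd : Normc.normc (1 - chi (cis q)) @[q --> p] --> Normc.normc (1 - chi (cis p)).
  exact: cvg_normc (cvgBC cst1 cc).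
have sqr (u : R -> R) (a : R) : u q @[q --> p] --> a -> u q ^+ 2 @[q --> p] --> a ^+ 2.
  move=> ua; apply: (@continuous_cvg _ _ _ _ _ _ (fun x : R => x ^+ 2)) => //.
  exact: exprn_continuous.
apply: cvgM; first exact: cvg_cst.
apply: cvgM; first by apply: cvgB; [exact: cvg_cst|exact: sqr].
apply: cvgV; last exact: sqr.
rewrite expf_neq0//; apply: contra_neq c1 => /Normc.eq0_normc/eqP.
by rewrite subr_eq0 => /eqP.
Qed.

(** Continuity may fail where [chi = 1]; there the zero denominator makes the density 0, so the line
    is split into an open set and its complement. *)
Lemma measurable_kappa_cis : measurable_fun setT K.
Proof.
pose D := [set p | Normc.normc (1 - chi (cis p)) != 0].
have oD : open D.
  rewrite (_ : D = (fun p => Normc.normc (1 - chi (cis p))) @^-1` [set y | y != 0])//.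
  apply: open_comp; last exact: open_neq.
  move=> p _.
  have cst1 : (fun=> 1 : plane R) @ p --> (1 : plane R) by exact: cvg_cst.
  exact: cvg_normc (cvgBC cst1 (@cvg_chi_cis p)).
have mD : measurable D by exact: open_measurable.
rewrite -(setUv D); apply/measurable_funU => //; first exact: measurableC.
split.
  apply: open_continuous_measurable_fun => // p; rewrite inE => Dp.
  apply: continuous_kappa_cis; apply: contra_neq Dp => ->.
  by rewrite subrr Normc.normc0.
apply: (eq_measurable_fun (cst (0 : R))); last exact: measurable_cst.
move=> p; rewrite inE => /negP; rewrite negbK => /eqP n0.
by rewrite /kappa n0 expr0n/= invr0 !mulr0.
Qed.

Let K_continuous x : x \in J -> {for phase t x, continuous K}.
Proof.
move=> /mem_angle_max_open Ax; apply: continuous_kappa_cis.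
rewrite (chi_phase t_gt0 chiP Ax).
have [S0 _ _] := log_rP t_gt0 Ax.
by apply: expC_neq1; rewrite coshN gt_eqF// coshBcos_gt0// gt_eqF.
Qed.

Let K_ge0 p : 0 <= K p.
Proof. by apply: (kappa_ge0 chiP); rewrite normc_cis. Qed.

(** [kappa_neq0_phase] gives [p] only modulo [2 pi]; [phase_range] and [cis_inj] make it an
    equality. The angle [pi], outside [J], would give [p = pi]. *)
Lemma kappa_support p : p \in `]- pi, pi[ -> K p != 0 -> (phase t @` [set` J]) p.
Proof.
rewrite in_itv/= => /andP[p1 p2] /(kappa_neq0_phase t_gt0 chiP)[x].
rewrite anglesE// => -[/= xpi Ax] pE.
have pI : p \in `]- pi, pi] by rewrite in_itv/= p1 ltW.
have [xE|xnpi] := eqVneq x pi.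
  move: pE; rewrite xE phase_pi => /(cis_inj pI); rewrite in_itv/= lexx andbT.
  by rewrite gtrN ?pi_gt0// => /(_ isT) pp; move: p2; rewrite pp ltxx.
have xJ : x \in J.
  rewrite mem_angle_max Ax andbT ltr_norml; move: xpi; rewrite in_itv/=.
  by move=> /andP[-> xpi]; rewrite lt_neqAle xnpi.
exists x => //; apply: (cis_inj _ pI) => //.
have := phase_range xJ; rewrite ltr_norml in_itv/= => /andP[-> /ltW ->].
by [].
Qed.

Lemma measurable_angles : measurable (angles t).
Proof.
rewrite anglesE//; apply: measurableI; first exact: measurable_itv.
by apply: open_measurable; exact: open_open_angles.
Qed.

Lemma measurable_a_t : measurable_fun (angles t) (a_t t).
Proof.
apply: (@measurable_funS _ _ _ _ A).
- by apply: open_measurable; exact: open_open_angles.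
- by rewrite anglesE// => x [].
apply: open_continuous_measurable_fun; first exact: open_open_angles.
by move=> x; rewrite inE => Ax; exact: continuous_a_t.
Qed.

Lemma measurable_phase : measurable_fun (angles t) (phase t).
Proof.
apply: (@measurable_funS _ _ _ _ A).
- by apply: open_measurable; exact: open_open_angles.
- by rewrite anglesE// => x [].
apply: open_continuous_measurable_fun; first exact: open_open_angles.
move=> x; rewrite inE => Ax; apply/differentiable_continuous/derivable1_diffP.
by case: (is_derive_phase t_gt0 Ax).
Qed.

Lemma angles_setD1 : angles t `\ pi = [set` J].
Proof.
rewrite anglesE//; apply/seteqP; split => x /=; rewrite mem_angle_max ltr_norml.
  move=> [[]]; rewrite in_itv/= => /andP[-> x2] -> /eqP xpi.
  by rewrite andbT lt_neqAle xpi.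
move=> /andP[/andP[x1 x2] Ax]; split; last by apply/eqP; rewrite lt_eqF.
by split; rewrite // in_itv/= x1 ltW.
Qed.

(** Removing the null point [pi] from both sides leaves the open interval [J], on which the
    substitution by [phase] applies. *)
Lemma pushforward_density (B : set R) : measurable B ->
  (\int[mu]_(x in angles t `&` phase t @^-1` B) (a_t t x)%:E =
   \int[mu]_(p in I `&` B) (K p)%:E)%E.
Proof.
move=> mB.
have mPB : measurable (angles t `&` phase t @^-1` B).
  exact: (measurable_phase measurable_angles).
have pD : (I `&` B) `\ pi = `](- pi : R), pi[%classic `&` B.
  apply/seteqP; split => p /=; rewrite !in_itv/=.
    by move=> [[/andP[-> p2] Bp] /eqP pp]; rewrite lt_neqAle pp p2.
  move=> [/andP[-> p2] Bp]; split; first by rewrite ltW.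
  by apply/eqP; rewrite lt_eqF.
have xD : (angles t `&` phase t @^-1` B) `\ pi = [set` J] `&` phase t @^-1` B.
  by rewrite -angles_setD1 !setDE setIAC.
have mJB : measurable ((angles t `&` phase t @^-1` B) `\ pi).
  exact: measurableD.
have mpB : measurable ((I `&` B) `\ pi).
  by apply: measurableD => //; exact: measurableI.
rewrite -(integral_setD1 mJB); last first.
  apply/measurable_EFinP; apply: measurable_funS measurable_a_t => //.
    exact: measurable_angles.
  by move=> x [[]].
rewrite -[RHS](integral_setD1 mpB); last first.
  by apply/measurable_EFinP; apply: measurable_funTS measurable_kappa_cis.
rewrite xD pD.
transitivity (\int[mu]_(x in [set` J] `&` phase t @^-1` B)
    (K (phase t x) * dphase t x)%:E)%E.
  apply: eq_integral => x; rewrite inE => -[/= /mem_angle_max_open Ax _].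
  by rewrite a_tE// (kappa_phase t_gt0 chiP Ax).
rewrite (change_of_variables dphase_derive dphase_continuous dphase_pos
  K_continuous (fun x _ => K_ge0 _))//; last first.
  by have := angle_max_gt0; lra.
(* Both integrands are extended by 0: the range of [phase] may be smaller than []-pi, pi[], but [K]
   vanishes on the difference. *)
rewrite integral_mkcond [RHS]integral_mkcond; apply: eq_integral => p _.
rewrite !patchE; case: ifPn => [|]; rewrite ?inE ?notin_setE.
  move=> [[x /= xJ <-] Bp]; rewrite ifT// inE; split => //=.
  by rewrite in_itv/= -ltr_norml phase_range.
move=> np; case: ifPn => //; rewrite inE => -[/= pI Bp].
have [-> //|k0] := eqVneq (K p) 0.
by case: np; split => //; exact: kappa_support.
Qed.

End Law.

Lemma probability_setI_full {d} {T : measurableType d} {R : realType}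
    (P : probability T R) (A B : set T) :
  measurable A -> measurable B -> P A = 1%E -> P (B `&` A) = P B.
Proof.
move=> mA mB PA.
have -> : P B = (P (B `\` A) + P (B `&` A))%E by rewrite -measureDI.
rewrite (_ : P (B `\` A) = 0%E) ?add0e//.
apply: (@subset_measure0 _ _ _ P _ (~` A)) => //.
- exact: measurableD.
- exact: measurableC.
by rewrite /= probability_setC// PA subee.
Qed.

Theorem proposition2p5 (R : realType) (t : R) (ht : 0 < t)
    (nu : probability (borel_plane R) R) (hnu : is_biane_measure t nu) :
  [/\ prob_density (angles t) (a_t t),
      (forall theta : R, angles t theta ->
         exists phi : R, f_t t ((r_t t theta)%:C * cis theta) = cis phi) &
      forall (d : measure_display) (Omega : measurableType d)
             (P : probability Omega R) (theta phi : {RV P >-> R}),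
        has_density theta (angles t) (a_t t) ->
        (forall w : Omega, angles t (theta w) ->
           f_t t ((r_t t (theta w))%:C * cis (theta w)) = cis (phi w)) ->
        forall B : set (borel_plane R), measurable B ->
          P [set w | B (cis (phi w))] = nu B].
Proof.
have [chi chiP nuE] := hnu.
have pushE (B : set (borel_plane R)) : measurable B ->
    (\int[lebesgue_measure]_(x in angles t `&` phase t @^-1` (@cis R @^-1` B))
       (a_t t x)%:E = nu B)%E.
  move=> mB; rewrite (pushforward_density ht chiP (measurable_cis mB)) (nuE _ mB).
  by congr (integral _ _ _).
(* The case where [B] is the whole plane. *)
have a_total : (\int[lebesgue_measure]_(x in angles t) (a_t t x)%:E = 1)%E.
  by rewrite -(probability_setT nu) -pushE// !preimage_setT setIT.
have phase_f_t x : angles t x -> f_t t ((r_t t x)%:C * cis x) = cis (phase t x).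
  by rewrite anglesE// => -[_ Ax]; exact: f_t_phase.
split.
- split; [exact: measurable_angles|exact: measurable_a_t| |exact: a_total].
  by rewrite anglesE// => x [_ Ax]; rewrite ltW// a_t_gt0.
- by move=> x Ax; exists (phase t x); exact: phase_f_t.
move=> d Omega P theta phi thetaP phiP B mB.
have mA := measurable_angles ht.
have mT : measurable (theta @^-1` angles t).
  by rewrite -[_ @^-1` _]setTI; exact: (measurable_funP theta).
(* The relation between [phi] and [theta] holds only when [theta] lies in [angles]; the density
   gives this event full probability, so the rest may be discarded. *)
have PA : (P (theta @^-1` angles t) = 1)%E.
  by rewrite -a_total -[angles t in RHS]setIid; exact: (thetaP _ mA).
have mE : measurable [set w | B (cis (phi w))].
  rewrite (_ : [set w | _] = setT `&` phi @^-1` (@cis R @^-1` B)); last by rewrite setTI.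
  by apply: (measurable_funP phi) => //; exact: measurable_cis.
have PE : (P [set w | B (cis (phi w))] =
    P (theta @^-1` (angles t `&` phase t @^-1` (@cis R @^-1` B))))%E.
  rewrite -(probability_setI_full mT mE PA).
  congr (P _); apply/seteqP; split => w /=; last first.
    by move=> [Aw]; rewrite -phase_f_t// phiP//.
  by move=> [Bw Aw]; split => //; rewrite -phase_f_t// phiP.
rewrite PE -(pushE _ mB).
have := thetaP _ (measurable_phase ht mA (measurable_cis mB)).
by rewrite setIA setIid => <-.
Qed.
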